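(* Let $k,n\ge1$ be integers and let $X:[0,1]^k\to\mathbb{R}^n$ be a Borel function. (i) If $0<\alpha<n$ and $\int_{\mathbb{R}^n}|\hat\mu_X(\xi)|\,|\xi|^{-\alpha}\,d\xi<+\infty$, then $U^\alpha\mu_X\in C_\infty(\mathbb{R}^n)$. (ii) If $\int_{\mathbb{R}^n}|\hat\mu_X(\xi)|\,d\xi<+\infty$, then $X$ has continuous local times $L_X\in C_\infty(\mathbb{R}^n)$.
   Context: The occupation measure of $X$ is $\mu_X(B)=\mathcal{L}^k(\{t\in[0,1]^k:X(t)\in B\})$, $B\subset\mathbb{R}^n$ Borel, where $\mathcal{L}^k$ is $k$-dimensional Lebesgue measure. If $\mu_X$ is absolutely continuous with respect to $\mathcal{L}^n$, its density $L_X=\frac{d\mu_X}{d\mathcal{L}^n}\in L^1(\mathbb{R}^n)$ is called the local time of $X$. The Fourier transform of $\mu_X$ is $\hat\mu_X(\xi)=\int_{\mathbb{R}^n}e^{i\langle x,\xi\rangle}\mu_X(dx)$. For $0<\alpha<n$ the Riesz potential is $U^\alpha\mu(x)=\int_{\mathbb{R}^n}|x-y|^{\alpha-n}\mu(dy)$. $C_\infty(\mathbb{R}^n)$ is the space of continuous functions on $\mathbb{R}^n$ vanishing at infinity. *)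

(* Defs.v *)
From HB Require Import structures.
From mathcomp Require Import all_boot all_order all_algebra.
From mathcomp Require Import all_classical all_reals all_analysis.
From mathcomp Require Import measurable_realfun complex.

Set Implicit Arguments.
Unset Strict Implicit.
Unset Printing Implicit Defensive.

Import Order.TTheory GRing.Theory Num.Theory.
Import numFieldNormedType.Exports numFieldTopology.Exports.

Local Open Scope classical_set_scope.
Local Open Scope ring_scope.
Local Open Scope charge_scope.

(* R^n is 'rV[R]_n.  Its library topology comes from the max norm, which is
   the usual topology; `|v| is the max norm, hence enorm below. *)

Section borel.
Context {R : realType} {n : nat}.

Let borel : set (set 'rV[R]_n) := <<s @open 'rV[R]_n >>.

Let borel0 : borel set0. Proof. exact: sigma_algebra0. Qed.

Let borelC A : borel A -> borel (~` A). Proof. exact: sigma_algebraC. Qed.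

Let borelU (F : (set 'rV[R]_n)^nat) :
  (forall i, borel (F i)) -> borel (\bigcup_i F i).
Proof. exact: sigma_algebra_bigcup. Qed.

HB.instance Definition _ := @isMeasurable.Build (sigma_display (@open 'rV[R]_n))
  'rV[R]_n borel borel0 borelC borelU.

Lemma rV_measurableE : @measurable _ 'rV[R]_n = <<s @open 'rV[R]_n >>.
Proof. by []. Qed.

Lemma open_measurable_rV (A : set 'rV[R]_n) : open A -> measurable A.
Proof. exact: sub_sigma_algebra. Qed.

Lemma measurable_coord (i : 'I_n) :
  measurable_fun [set: 'rV[R]_n] (fun v => v ord0 i).
Proof.
move=> mT; apply: (measurability _ (RGenOpens.measurableE R)) => //.
move=> _ [_ [a [b ->] <-]]; rewrite setTI; apply: open_measurable_rV.
apply: open_comp; last exact: interval_open.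
by move=> v _; exact: coord_continuous.
Qed.

Let rat_box (p : 'rV[rat]_n * rat) : set 'rV[R]_n :=
  [set v | forall i, `|v ord0 i - ratr (p.1 ord0 i)| < ratr p.2].

Let open_rV_bigcup_rat (U : set 'rV[R]_n) : open U ->
  U = \bigcup_(p in [set p | rat_box p `<=` U]) rat_box p.
Proof.
move=> oU; apply/seteqP; split; last by move=> v [p] /[apply].
move=> v Uv; have /nbhs_ballP[e /= e0 eU] : nbhs v U by exact: open_nbhs_nbhs.
have [r /andP[r0 re]] : exists r : rat, 0 < (ratr r : R) < e / 2.
  have /rat_in_itvoo[r] : 0 < e / 2 by rewrite divr_gt0.
  by rewrite in_itv/= => ?; exists r.
have /choice[q qv] i : exists q : rat, `|v ord0 i - ratr q| < ratr r.
  have /rat_in_itvoo[q] : v ord0 i - ratr r < v ord0 i + ratr r.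
    by rewrite ltrBlDr -addrA ltrDl addr_gt0.
  rewrite in_itv/= => /andP[? ?]; exists q.
  by rewrite distrC ltr_distl; apply/andP.
exists (\row_i q i, r) => /=; last by move=> i; rewrite mxE; exact: qv.
move=> w /= qw; apply: eU; split=> // j i; rewrite (ord1 j) /ball/=.
have := qw i; rewrite /= mxE => qwi.
rewrite -(subrKA (ratr (q i))) (le_lt_trans (ler_normD _ _))//.
rewrite (splitr e) ltrD//; first exact: lt_trans (qv i) re.
by rewrite distrC; exact: lt_trans qwi re.
Qed.

Lemma measurable_fun_rV d (T : measurableType d) (D : set T)
    (f : T -> 'rV[R]_n) :
  (forall i, measurable_fun D (fun x => f x ord0 i)) -> measurable_fun D f.
Proof.
move=> mf mD; apply: (measurability _ rV_measurableE) => //.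
move=> _ [U oU <-]; rewrite (open_rV_bigcup_rat oU) preimage_bigcup.
rewrite setI_bigcupr bigcup_mkcond; apply: countable_bigcupT_measurable => //.
move=> -[q r]; case: ifPn => // _.
rewrite (_ : _ `&` _ = D `&` \bigcap_(i in [set: 'I_n]) (D `&`
    (fun x => f x ord0 i) @^-1` ball (ratr (q ord0 i) : R) (ratr r))); last first.
  apply/seteqP; split=> [x [Dx] /= fx|x [Dx] /= fx].
    by split=> // i _; split => //; rewrite /ball/= distrC; exact: fx.
  by split=> // i; have [_] := fx i I; rewrite /ball/= distrC.
apply: measurableI => //; apply: fin_bigcap_measurable => // i _.
by apply: mf => //; exact: measurable_ball.
Qed.

End borel.

Section lebesgue.
Context {R : realType}.
Local Open Scope ereal_scope.

Definition rV_cons n (p : R * 'rV[R]_n) : 'rV[R]_n.+1 := row_mx p.1%:M p.2.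

Lemma rV_cons0 n (p : R * 'rV[R]_n) : rV_cons p ord0 ord0 = p.1.
Proof.
transitivity (row_mx p.1%:M p.2 ord0 (lshift n ord0)).
  by congr (row_mx _ _ _ _); exact/val_inj.
by rewrite row_mxEl mxE eqxx.
Qed.

Lemma rV_consS n (p : R * 'rV[R]_n) i :
  rV_cons p ord0 (lift ord0 i) = p.2 ord0 i.
Proof.
transitivity (row_mx p.1%:M p.2 ord0 (rshift 1 i)).
  by congr (row_mx _ _ _ _); exact/val_inj.
by rewrite row_mxEr.
Qed.

Lemma measurable_rV_cons n : measurable_fun setT (@rV_cons n).
Proof.
apply: measurable_fun_rV => i; have [->|[j ->]] : i = ord0 \/ exists j, i = lift ord0 j.
- by case: (unliftP ord0 i) => [j ->|->]; [right; exists j|left].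
- by under eq_fun do rewrite rV_cons0; exact: measurable_fst.
under eq_fun do rewrite rV_consS.
exact: measurableT_comp (measurable_coord j) measurable_snd.
Qed.

Section step.
Variables (n : nat) (mu : {sigma_finite_measure set 'rV[R]_n -> \bar R}).

Definition lebesgue_step : set 'rV[R]_n.+1 -> \bar R :=
  pushforward (lebesgue_measure \x mu) (@rV_cons n).

HB.instance Definition _ := Measure.copy lebesgue_step
  (measure_function_pushforward__canonical__measure_function_Measure
     (lebesgue_measure \x mu) (@measurable_rV_cons n)).

Lemma lebesgue_stepE (A : set R) (B : set 'rV[R]_n) :
  measurable A -> measurable B ->
  lebesgue_step [set v : 'rV[R]_n.+1 |
      A (v ord0 ord0) /\ B (\row_i v ord0 (lift ord0 i))] =
    lebesgue_measure A * mu B.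
Proof.
move=> mA mB; rewrite -product_measure1E//; congr (product_measure1 _ _ _).
apply/seteqP; split=> -[x v] /=; rewrite rV_cons0;
  rewrite (_ : \row_i _ = v)//; apply/rowP => i; by rewrite mxE rV_consS.
Qed.

Let lebesgue_step_sigma_finite : sigma_finite setT lebesgue_step.
Proof.
have /sigma_finiteP[F [TF ndF Foo]] := sigma_finiteT
  (lebesgue_measure : {sigma_finite_measure set (measurableTypeR R) -> \bar R}).
have /sigma_finiteP[G [TG ndG Goo]] := sigma_finiteT mu.
exists (fun k => [set v : 'rV[R]_n.+1 |
    F k (v ord0 ord0) /\ G k (\row_i v ord0 (lift ord0 i))]).
  apply/seteqP; split=> // v _.
  have [i _ Fi] : (\bigcup_i F i) (v ord0 ord0) by rewrite -TF.
  have [j _ Gj] : (\bigcup_i G i) (\row_i v ord0 (lift ord0 i)) by rewrite -TG.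
  exists (maxn i j) => //; split.
  - by move: Fi; exact/subsetPset/ndF/leq_maxl.
  - by move: Gj; exact/subsetPset/ndG/leq_maxr.
move=> k; have [mF Fk] := Foo k; have [mG Gk] := Goo k; split; last first.
  by rewrite lebesgue_stepE// lte_mul_pinfty// ge0_fin_numE.
apply: measurableI.
  by rewrite -[X in measurable X]setTI; exact: measurable_coord.
rewrite -[X in measurable X]setTI; apply: measurable_fun_rV => // i.
by under eq_fun do rewrite mxE; exact: measurable_coord.
Qed.

HB.instance Definition _ := Measure_isSigmaFinite.Build _ _ _ lebesgue_step
  lebesgue_step_sigma_finite.

End step.

(* n-fold product of one-dimensional Lebesgue measure; lebesgue_rV_box below
   gives its values on boxes. *)
Fixpoint lebesgue_rV n : {sigma_finite_measure set 'rV[R]_n -> \bar R} :=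
  if n is n'.+1 then lebesgue_step (lebesgue_rV n') else \d_(0%R : 'rV[R]_0).

Lemma lebesgue_rV_box n (A : 'I_n -> set R) : (forall i, measurable (A i)) ->
  lebesgue_rV n [set v : 'rV[R]_n | forall i, A i (v ord0 i)] =
    \prod_(i < n) lebesgue_measure (A i).
Proof.
elim: n A => [|n IH] A mA /=.
  by rewrite big_ord0 diracE mem_set//= => -[].
rewrite big_ord_recl -IH// -lebesgue_stepE//; last first.
  rewrite (_ : mkset _ = \bigcap_(i in [set: 'I_n])
      (fun v : 'rV[R]_n => v ord0 i) @^-1` A (lift ord0 i)).
    apply: fin_bigcap_measurable => // i _; rewrite -[X in measurable X]setTI.
    exact: measurable_coord.
  by apply/seteqP; split=> v /= Av i; [move=> _|]; exact: Av.
congr (lebesgue_step _ _); apply/seteqP; split=> v /=.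
  by move=> Av; split => // i; rewrite mxE.
move=> [A0 AS] i; have [->//|[j ->]] : i = ord0 \/ exists j, i = lift ord0 j.
  by case: (unliftP ord0 i) => [j ->|->]; [right; exists j|left].
by have := AS j; rewrite mxE.
Qed.

End lebesgue.

Definition unit_cube {R : realType} (k : nat) : set 'rV[R]_k :=
  [set t | forall i, t ord0 i \in `[0, 1]].
Arguments unit_cube {R} k.

Lemma measurable_unit_cube {R : realType} k :
  measurable (unit_cube k : set 'rV[R]_k).
Proof.
rewrite (_ : unit_cube k = \bigcap_(i in [set: 'I_k])
    (fun v : 'rV[R]_k => v ord0 i) @^-1` `[0, 1]%classic).
  apply: fin_bigcap_measurable => // i _; rewrite -[X in measurable X]setTI.
  exact: measurable_coord.
by apply/seteqP; split=> v /= Av i; [move=> _|]; exact: Av.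
Qed.

Lemma lebesgue_unit_cube {R : realType} k :
  lebesgue_rV k (unit_cube k : set 'rV[R]_k) = 1%E.
Proof.
rewrite (lebesgue_rV_box (A := fun=> `[0, 1]%classic))// big1// => i _.
by rewrite lebesgue_measure_itv/= lte_fin ltr01 oppr0 adde0.
Qed.

Section occupation.
Context {R : realType} {k n : nat} (X : 'rV[R]_k -> 'rV[R]_n).
Local Open Scope ereal_scope.

(* Only the values of X on the unit cube matter.  The measurability argument
   is there for the measure structure below. *)
Definition occupation of measurable_fun (unit_cube k) X
    : set 'rV[R]_n -> \bar R :=
  fun B => lebesgue_rV k (unit_cube k `&` X @^-1` B).

Variable mX : measurable_fun (unit_cube k) X.

Let mXB B : measurable B -> measurable (unit_cube k `&` X @^-1` B).
Proof. by move=> mB; apply: mX => //; exact: measurable_unit_cube. Qed.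

Let occupation0 : occupation mX set0 = 0.
Proof. by rewrite /occupation preimage_set0 setI0 measure0. Qed.

Let occupation_ge0 B : 0 <= occupation mX B.
Proof. exact: measure_ge0. Qed.

Let occupation_sigma_additive : semi_sigma_additive (occupation mX).
Proof.
move=> F mF tF mUF; rewrite /occupation preimage_bigcup setI_bigcupr.
apply: measure_semi_sigma_additive.
- by move=> i; exact: mXB.
- apply/trivIsetP => i j _ _ ij; rewrite setIACA setIid -preimage_setI.
  by move/trivIsetP : tF => /(_ _ _ _ _ ij) ->//; rewrite preimage_set0 setI0.
- by rewrite -setI_bigcupr -preimage_bigcup; exact: mXB.
Qed.

HB.instance Definition _ := isMeasure.Build _ _ _ (occupation mX)
  occupation0 occupation_ge0 occupation_sigma_additive.

Let occupation_finite : fin_num_fun (occupation mX).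
Proof.
move=> B mB; rewrite ge0_fin_numE ?measure_ge0//.
apply: (@le_lt_trans _ _ (lebesgue_rV k (unit_cube k : set 'rV[R]_k))).
  apply: le_measure; rewrite ?inE; [exact: mXB|exact: measurable_unit_cube|].
  exact: subIsetl.
by rewrite lebesgue_unit_cube ltry.
Qed.

HB.instance Definition _ := Measure_isFinite.Build _ _ _ (occupation mX)
  occupation_finite.

End occupation.

Section fourier_riesz.
Context {R : realType} {n : nat}.

Definition dotp (x y : 'rV[R]_n) : R := \sum_(i < n) x ord0 i * y ord0 i.

Definition enorm (x : 'rV[R]_n) : R := Num.sqrt (dotp x x).

(* e^(it) *)
Definition expi (t : R) : R[i] := (cos t +i* sin t)%C.

Definition Cintegral d (T : measurableType d) (mu : {measure set T -> \bar R})
    (D : set T) (f : T -> R[i]) : R[i] :=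
  ((\int[mu]_(x in D) complex.Re (f x)) +i*
   (\int[mu]_(x in D) complex.Im (f x)))%C.

Definition fourier (mu : {measure set 'rV[R]_n -> \bar R}) (xi : 'rV[R]_n) : R[i] :=
  Cintegral mu setT (fun x => expi (dotp x xi)).

(* r^s for r >= 0, with 0^s = +oo for s < 0: powR alone gives 0 `^ s = 0
   there, so that the Riesz potential of a measure would ignore an atom at the
   point where it is evaluated. *)
Definition epowR (r s : R) : \bar R :=
  if (r == 0) && (s < 0) then +oo%E else (r `^ s)%:E.

Definition riesz_potential (alpha : R) (mu : {measure set 'rV[R]_n -> \bar R})
    (x : 'rV[R]_n) : \bar R :=
  (\int[mu]_y epowR (enorm (x - y)%R) (alpha - n%:R)%R)%E.

Definition C_infty (f : 'rV[R]_n -> R) : Prop :=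
  continuous f /\
  forall e, 0 < e -> exists M, forall x, M <= enorm x -> `|f x| < e.

Definition is_local_time k (X : 'rV[R]_k -> 'rV[R]_n)
    (mX : measurable_fun (unit_cube k) X) (L : 'rV[R]_n -> R) : Prop :=
  occupation mX `<< lebesgue_rV n /\
  ae_eq (lebesgue_rV n) setT
    ('d (charge_of_finite_measure (occupation mX)) '/d (lebesgue_rV n))
    (EFin \o L).

End fourier_riesz.

(* Main.v *)
(* Write [w s x] for the integral of [exp (- s^2 |x - y|^2 / 2)] against the
   occupation measure [mu].  It lies in C_infty, and the Fourier transform of
   the Gaussian turns it into the integral of [cos (<xi, x - y>)] against [mu]
   and against the centred normal density in [xi] of standard deviation [s],
   so that it is bounded, uniformly in [x], by the integral of [|mu^|] against
   this density.
   (i) The Riesz kernel is a mixture of Gaussians, by the Gamma integral.  Up to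
   a constant, the Riesz potential is therefore the integral over [s] of
   multiples of [w s x], and integrating the above bound over [s] gives a
   multiple of the integral of [|mu^| |xi|^(- alpha)].  Dominated convergence in
   [s] then transfers membership in C_infty to the potential, and no
   Riemann-Lebesgue lemma is needed.
   (ii) The normalized [w s] are the convolutions of [mu] with an approximate
   identity; they converge uniformly to the inverse Fourier integral of [mu^],
   which is thus in C_infty.  Testing against continuous functions increasing
   to the indicator of an open set shows that the limit is the density of
   [mu]. *)
From HB Require Import structures.
Require Import Defs.
From mathcomp Require Import all_boot all_order all_algebra.
From mathcomp Require Import all_classical all_reals all_analysis.
From mathcomp Require Import complex ring lra measurable_realfun.

Set Implicit Arguments.
Unset Strict Implicit.
Unset Printing Implicit Defensive.

Import Order.TTheory GRing.Theory Num.Theory.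
Import numFieldNormedType.Exports.

Local Open Scope classical_set_scope.
Local Open Scope ring_scope.

(** * Fourier transform of the Gaussian *)

Section gaussian_1d.
Context {R : realType}.
Local Notation leb := (@lebesgue_measure R).

(** By dominated convergence the integral is the limit of the integrals over [[-n, n]], which the
    fundamental theorem of calculus evaluates as [F n - F (- n)]. *)
Lemma integral_derivative_eq0 (F f : R -> R) :
  (forall x : R, is_derive x 1 F (f x)) -> continuous f ->
  leb.-integrable setT (EFin \o f) ->
  F n%:R @[n --> \oo] --> 0 -> F (- n%:R) @[n --> \oo] --> 0 ->
  (\int[leb]_x (f x)%:E = 0)%E.
Proof.
move=> dF cf fint Fy FNy.
pose I n := `[- n%:R, n%:R : R]%classic.
have dcvg : (\int[leb]_x ((f \_ (I n)) x)%:E)%E @[n --> \oo] -->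
    (\int[leb]_x (f x)%:E)%E.
  apply: (@dominated_cvg _ _ _ leb _ measurableT (fun n x => ((f \_ (I n)) x)%:E)
    (EFin \o f) (abse \o (EFin \o f))) => //.
  - move=> n; apply/measurable_EFinP; apply/(measurable_restrictT _ _).1.
      exact: measurable_itv.
    by apply: measurable_funTS; exact: continuous_measurable_fun.
  - move=> x _; apply: cvg_near_cst; near=> n.
    rewrite patchE mem_set//= /I/= in_itv/= -ler_norml.
    by near: n; exact: nbhs_infty_ger.
  - exact: integrable_abse.
  - move=> n x _ /=; rewrite lee_fin patchE; case: ifPn => // _.
    by rewrite normr0.
(* The shift to [n.+1] keeps the interval nondegenerate. *)
have {}dcvg : (F n.+1%:R - F (- n.+1%:R))%:E @[n --> \oo] -->
    (\int[leb]_x (f x)%:E)%E.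
  move: dcvg; rewrite -cvg_shiftS; apply: cvg_trans; apply: near_eq_cvg.
  apply: nearW => n /=; rewrite EFinB -(@continuous_FTC2 _ f F) //.
  - rewrite [RHS]integral_mkcond; apply: eq_integral => x _.
    by rewrite restrict_EFin.
  - by rewrite -subr_gt0 opprK addr_gt0.
  - exact: continuous_subspaceT.
  - have cF x : {for x, continuous F}.
      by apply/differentiable_continuous/derivable1_diffP; have [] := dF x.
    split=> [x _||]; first by have [] := dF x.
    + exact/cvg_at_right_filter/cF.
    + exact/cvg_at_left_filter/cF.
  - by move=> x _; rewrite derive1E; have [_ ->] := dF x.
apply: (cvg_unique _ dcvg) => //; apply: cvg_EFin; first exact: nearW.
rewrite -(subr0 0); apply: cvgB.
- by rewrite (@cvg_shiftS _ (fun n => F n%:R)).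
- by rewrite (@cvg_shiftS _ (fun n => F (- n%:R))).
Unshelve. all: by end_near. Qed.


Lemma normal_peakE (s : R) : normal_peak s = `|s|^-1 * normal_peak 1.
Proof.
rewrite /normal_peak expr1n mul1r -mulrnAr sqrtrM ?sqr_ge0//.
by rewrite sqrtr_sqr invfM.
Qed.

Lemma normal_peak_double (s : R) : normal_peak s = 2 * normal_peak (2 * s).
Proof.
rewrite (normal_peakE s) (normal_peakE (2 * s)) normrM normr_nat invfM.
by rewrite !mulrA divff ?mul1r.
Qed.

(** Doubling the standard deviation sets free a Gaussian factor, with exponent [1/2 - 1/8 = 3/8],
    that can absorb polynomial growth or measure tails. *)
Lemma normal_pdf_double (m s x : R) : s != 0 ->
  normal_pdf m s x =
  2 * expR (- (x - m) ^+ 2 * 3 / (8 * s ^+ 2)) * normal_pdf m (2 * s) x.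
Proof.
move=> s0; have s20 : 2 * s != 0 by rewrite mulf_neq0.
rewrite !normal_pdfE// mulrAC mulrA -mulrA /normal_fun -expRD; congr (_ * expR _).
  exact: normal_peak_double.
by field.
Qed.

Lemma norm_normal_pdf_le (m s x : R) : s != 0 ->
  `|x - m| * normal_pdf m s x <=
  (2 + 6 * s ^+ 2) * normal_pdf m (2 * s) x.
Proof.
move=> s0; rewrite normal_pdf_double// mulrA ler_wpM2r ?normal_pdf_ge0//.
set y := x - m; set c : R := 3 / (8 * s ^+ 2).
have s2 : 0 < s ^+ 2 by rewrite exprn_even_gt0.
have c0 : 0 < c by rewrite divr_gt0// mulr_gt0.
rewrite (_ : - y ^+ 2 * 3 / (8 * s ^+ 2) = - (c * y ^+ 2)); last by rewrite /c; field.
rewrite expRN mulrA ler_pdivrMr ?expR_gt0//.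
have := expR_ge1Dx (c * y ^+ 2) => ec.
(* By the choice of [c], the term [6 * s ^+ 2 * (c * y ^+ 2)] is [9 / 4 * y ^+ 2]; together with [2]
   it exceeds [2 * |y|] whatever [s] is. *)
apply: (@le_trans _ _ ((2 + 6 * s ^+ 2) * (1 + c * y ^+ 2))); last first.
  by apply: ler_wpM2l ec; lra.
have : 0 <= (`|y| - 1) ^+ 2 by exact: sqr_ge0.
have : 6 * s ^+ 2 * (c * y ^+ 2) = 9 / 4 * y ^+ 2 by rewrite /c; field.
have : 0 <= c * y ^+ 2 by rewrite mulr_ge0 ?sqr_ge0// ltW.
rewrite -(real_normK (num_real y)) mulrDl !mulrDr.
by set a := `|y|; nra.
Qed.

Lemma integrable_normal_pdfM (m s : R) (f : R -> R) (C : R) :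
  measurable_fun setT f -> (forall x, `|f x| <= C) ->
  leb.-integrable setT (fun x => (normal_pdf m s x * f x)%:E).
Proof.
move=> mf fC.
apply: (@le_integrable _ _ _ leb _ measurableT _ (fun x => (C * normal_pdf m s x)%:E)) => //.
- by apply/measurable_EFinP; apply: measurable_funM => //; exact: measurable_normal_pdf.
- move=> x _; rewrite lee_fin !normrM (ger0_norm (normal_pdf_ge0 _ _ _)) mulrC.
  by rewrite ler_wpM2r ?normal_pdf_ge0// (le_trans (fC x))// ler_norm.
- under eq_fun do rewrite EFinM.
  by apply: integrableZl => //; exact: integrable_normal_pdf.
Qed.

Lemma integrable_norm_normal_pdf (m s : R) : s != 0 ->
  leb.-integrable setT (fun x => (`|x - m| * normal_pdf m s x)%:E).
Proof.
move=> s0.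
apply: (@le_integrable _ _ _ leb _ measurableT _
  (fun x => ((2 + 6 * s ^+ 2) * normal_pdf m (2 * s) x)%:E)) => //.
- apply/measurable_EFinP; apply: measurable_funM; last exact: measurable_normal_pdf.
  by apply: measurableT_comp => //; exact: measurable_funB.
- move=> x _; rewrite !abse_EFin lee_fin ger0_norm ?mulr_ge0 ?normal_pdf_ge0//.
  by rewrite (le_trans (norm_normal_pdf_le _ _ _))// ler_norm.
- under eq_fun do rewrite EFinM.
  by apply: integrableZl => //; exact: integrable_normal_pdf.
Qed.

Lemma is_derive_normal_pdf (m s x : R) : s != 0 ->
  is_derive x 1 (normal_pdf m s) (- (x - m) / s ^+ 2 * normal_pdf m s x).
Proof.
move=> s0; rewrite normal_pdfE// /normal_fun.
apply: is_derive_eq; rewrite /GRing.scale/=.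
by field.
Qed.


Lemma continuous_cos_affine (t z m : R) : continuous (fun x => cos (t + z * (x - m))).
Proof.
move=> x; apply: continuous_comp; last exact: continuous_cos.
apply: cvgD; first exact: cvg_cst.
by apply: cvgM; [exact: cvg_cst|apply: cvgB; [exact: cvg_id|exact: cvg_cst]].
Qed.


(** The product of [|x - m|] and the density is bounded by a constant [C], so the density is at most
    [C / |x - m|]. *)
Lemma normal_pdf_small (m s e : R) : s != 0 -> 0 < e ->
  exists N, forall x, N <= `|x| -> normal_pdf m s x < e.
Proof.
move=> s0 e0; set C : R := (2 + 6 * s ^+ 2) * normal_peak (2 * s).
have C0 : 0 < C.
  by rewrite mulr_gt0 ?normal_peak_gt0 ?mulf_neq0// ltr_wpDr// mulr_ge0 ?sqr_ge0.
exists (`|m| + C / e + 1) => x Nx.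
have xm : C / e + 1 <= `|x - m|.
  by have := lerB_dist x m; lra.
have Ce0 : 0 < C / e by rewrite divr_gt0.
have xm0 : 0 < `|x - m| by lra.
have pC : `|x - m| * normal_pdf m s x <= C.
  apply: le_trans (norm_normal_pdf_le _ _ s0) _; rewrite ler_wpM2l//.
    by rewrite addr_ge0// mulr_ge0 ?sqr_ge0.
  by apply: normal_pdf_ub; rewrite mulf_neq0.
rewrite -(ltr_pM2l xm0); apply: le_lt_trans pC _.
by rewrite -ltr_pdivrMr//; lra.
Qed.

Lemma cvg_normal_pdf_pinfty (m s : R) : s != 0 ->
  normal_pdf m s n%:R @[n --> \oo] --> 0.
Proof.
move=> s0; apply/cvgrPdist_lt => e e0; have [N pN] := normal_pdf_small m s0 e0.
near=> n; rewrite sub0r normrN ger0_norm ?normal_pdf_ge0//; apply: pN.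
by rewrite normr_nat; near: n; exact: nbhs_infty_ger.
Unshelve. all: by end_near. Qed.

Lemma cvg_normal_pdf_ninfty (m s : R) : s != 0 ->
  normal_pdf m s (- n%:R) @[n --> \oo] --> 0.
Proof.
move=> s0; apply/cvgrPdist_lt => e e0; have [N pN] := normal_pdf_small m s0 e0.
near=> n; rewrite sub0r normrN ger0_norm ?normal_pdf_ge0//; apply: pN.
by rewrite normrN normr_nat; near: n; exact: nbhs_infty_ger.
Unshelve. all: by end_near. Qed.

Lemma cvg0_mul_bounded (u v : nat -> R) (C : R) : (forall n, `|v n| <= C) ->
  u n @[n --> \oo] --> 0 -> u n * v n @[n --> \oo] --> 0.
Proof.
move=> vC u0; apply: norm_cvg0.
apply: (@squeeze_cvgr _ _ _ _ (cst 0) (fun n => `|u n| * C)).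
- by apply: nearW => n /=; rewrite normr_ge0/= normrM ler_wpM2l.
- exact: cvg_cst.
- rewrite -(mul0r C); apply: cvgM; last exact: cvg_cst.
  by rewrite -(@normr0 _ R); exact: cvg_norm.
Qed.

Lemma continuous_sin_affine (t z m : R) :
  continuous (fun x => sin (t + z * (x - m))).
Proof.
move=> x; apply: continuous_comp; last exact: continuous_sin.
apply: cvgD; first exact: cvg_cst.
by apply: cvgM; [exact: cvg_cst|apply: cvgB; [exact: cvg_id|exact: cvg_cst]].
Qed.

Lemma integrable_EFinZl d (T : measurableType d) (nu : {measure set T -> \bar R})
    (k : R) (f : T -> R) :
  nu.-integrable setT (fun x => (f x)%:E) ->
  nu.-integrable setT (fun x => (k * f x)%:E).
Proof. by move=> fi; under eq_fun do rewrite EFinM; exact: integrableZl. Qed.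

Lemma integrable_normal_cos (m s t z : R) :
  leb.-integrable setT (fun x => (normal_pdf m s x * cos (t + z * (x - m)))%:E).
Proof.
apply: (@integrable_normal_pdfM _ _ _ 1) => [|x]; last exact: cos_max.
by apply: continuous_measurable_fun; exact: continuous_cos_affine.
Qed.

Lemma integrable_normal_sin (m s t z : R) : s != 0 ->
  leb.-integrable setT
    (fun x => (normal_pdf m s x * ((x - m) * sin (t + z * (x - m))))%:E).
Proof.
move=> s0.
apply: (@le_integrable _ _ _ leb _ measurableT _
  (fun x => (`|x - m| * normal_pdf m s x)%:E)) => //.
- apply/measurable_EFinP; apply: measurable_funM; first exact: measurable_normal_pdf.
  apply: measurable_funM; first exact: measurable_funB.
  by apply: continuous_measurable_fun; exact: continuous_sin_affine.
- move=> x _; rewrite !abse_EFin lee_fin !normrM normr_id.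
  rewrite mulrCA ler_wpM2l// ler_piMr//; exact: sin_max.
- exact: integrable_norm_normal_pdf.
Qed.

(* Stein's identity: the derivative of the product of the density with
   [sin (t + z * (x - m))] has zero integral. *)
Lemma normal_stein_sin (m s t z : R) : s != 0 ->
  \int[leb]_x (normal_pdf m s x * ((x - m) * sin (t + z * (x - m)))) =
  s ^+ 2 * z * \int[leb]_x (normal_pdf m s x * cos (t + z * (x - m))).
Proof.
move=> s0; have s20 : s ^+ 2 != 0 by rewrite sqrf_eq0.
pose F x := normal_pdf m s x * sin (t + z * (x - m)).
pose f x := (- (s ^+ 2)^-1) * (normal_pdf m s x * ((x - m) * sin (t + z * (x - m))))
  + z * (normal_pdf m s x * cos (t + z * (x - m))).
have iS := integrable_normal_sin m t z s0.
have iC := integrable_normal_cos m s t z.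
have dF (x : R) : is_derive x 1 F (f x).
  have ? := is_derive_normal_pdf m x s0.
  by apply: is_derive_eq; rewrite /GRing.scale/= /f; field.
have fE : \int[leb]_x f x = 0.
  rewrite /Rintegral (integral_derivative_eq0 dF)//.
  - move=> x; apply: cvgD.
      apply: cvgM; first exact: cvg_cst.
      apply: cvgM; first exact: continuous_normal_pdf.
      apply: cvgM; last exact: continuous_sin_affine.
      by apply: cvgB; [exact: cvg_id|exact: cvg_cst].
    apply: cvgM; first exact: cvg_cst.
    apply: cvgM; first exact: continuous_normal_pdf.
    exact: continuous_cos_affine.
  - rewrite /f/comp; under eq_fun do rewrite EFinD.
    by apply: integrableD => //; exact: integrable_EFinZl.
  - apply: (@cvg0_mul_bounded _ _ 1) => [n|]; first exact: sin_max.
    exact: cvg_normal_pdf_pinfty.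
  - apply: (@cvg0_mul_bounded _ _ 1) => [n|]; first exact: sin_max.
    exact: cvg_normal_pdf_ninfty.
move: fE; rewrite /f RintegralD//; last 2 first.
- exact: integrable_EFinZl.
- exact: integrable_EFinZl.
rewrite !RintegralZl//.
set A := \int[leb]_x _; set B := \int[leb]_x _ => AB.
rewrite -mulrA; apply: (mulfI (invr_neq0 s20)); rewrite mulKf//.
by apply/eqP; rewrite eq_sym -subr_eq0 addrC -mulNr AB.
Qed.

(* By Stein's identity, both sides solve [phi' z = - s^2 z phi z]. *)
Lemma normal_charfun (m s t z : R) : s != 0 ->
  \int[leb]_x (normal_pdf m s x * cos (t + z * (x - m))) =
  cos t * expR (- (s ^+ 2 * z ^+ 2 / 2)).
Proof.
move=> s0.
pose phi z := \int[leb]_x (normal_pdf m s x * cos (t + z * (x - m))).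
have dcos (w x : R) : is_derive w 1
    (fun w => normal_pdf m s x * cos (t + w * (x - m)))
    (- (normal_pdf m s x * ((x - m) * sin (t + w * (x - m))))).
  by apply: is_derive_eq; rewrite /GRing.scale/=; ring.
have d1E (w x : R) :
    partial1of2 (fun z x => normal_pdf m s x * cos (t + z * (x - m))) w x =
    - (normal_pdf m s x * ((x - m) * sin (t + w * (x - m)))).
  by rewrite partial1of2E; have [_ ->] := dcos w x.
have dphi (w : R) : is_derive w 1 phi (- (s ^+ 2 * w) * phi w).
  (* The dominating function in [h5] does not involve the frequency, so any open interval around [w]
     will do. *)
  have Iw : `]w - 1, w + 1[%classic w by rewrite /= in_itv/=; lra.
  have h1 x : `]w - 1, w + 1[%classic x -> leb.-integrable setT
      (EFin \o (fun y => normal_pdf m s y * cos (t + x * (y - m)))).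
    by move=> _; exact: integrable_normal_cos.
  have h2 (x y : R) : `]w - 1, w + 1[%classic x -> [set: R] y ->
      derivable (fun x : R => normal_pdf m s y * cos (t + x * (y - m))) x 1.
    by move=> _ _; have [] := dcos x y.
  have h3 y : 0 <= `|y - m| * normal_pdf m s y by rewrite mulr_ge0 ?normal_pdf_ge0.
  have h4 := integrable_norm_normal_pdf m s0.
  have h5 (x y : R) : `]w - 1, w + 1[%classic x -> [set: R] y ->
      `|partial1of2 (fun z x => normal_pdf m s x * cos (t + z * (x - m))) x y| <=
      `|y - m| * normal_pdf m s y.
    move=> _ _; rewrite d1E normrN !normrM (ger0_norm (normal_pdf_ge0 _ _ _)).
    by rewrite mulrCA ler_wpM2l// ler_piMr ?normal_pdf_ge0//; exact: sin_max.
  apply: DeriveDef.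
    exact: (derivable_under_integral measurableT Iw h1 h2 h3 h4 h5).
  rewrite -derive1E (differentiation_under_integral measurableT Iw h1 h2 h3 h4 h5).
  transitivity (\int[leb]_x (-1 *
      (normal_pdf m s x * ((x - m) * sin (t + w * (x - m)))))).
    by apply: eq_Rintegral => x _; rewrite d1E mulN1r.
  rewrite RintegralZl//; last exact: integrable_normal_sin.
  by rewrite normal_stein_sin// mulN1r mulNr.
(* With this integrating factor the differential equation says that [g] has zero derivative. *)
pose g w := phi w * expR (s ^+ 2 * w ^+ 2 / 2).
have dg (w : R) : is_derive w 1 g 0.
  have ? := dphi w.
  apply: is_derive_eq; rewrite /GRing.scale/=.
  by field.
have gE : g z = g 0 := is_derive_0_is_cst z 0 dg.
move: gE; rewrite /g expr0n/= mulr0 mul0r expR0 mulr1.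
have -> : phi 0 = cos t.
  rewrite /phi; under eq_Rintegral do rewrite mul0r addr0 mulrC.
  rewrite RintegralZl//; last exact: integrable_normal_pdf.
  by rewrite /Rintegral integral_normal_pdf mulr1.
by move=> <-; rewrite expRN mulfK// gt_eqF ?expR_gt0.
Qed.

End gaussian_1d.

(** * Row vectors: measurability, and Tonelli's theorem splitting off the first coordinate *)

Section row_vectors.
Context {R : realType}.

Lemma measurable_rVB n d (T : measurableType d) (D : set T)
    (f g : T -> 'rV[R]_n) :
  measurable_fun D f -> measurable_fun D g ->
  measurable_fun D (fun x => f x - g x).
Proof.
move=> mf mg; apply: measurable_fun_rV => i.
under eq_fun do rewrite !mxE.
by apply: measurable_funB; exact: measurableT_comp (measurable_coord i) _.
Qed.

Lemma measurable_dotp n d (T : measurableType d) (D : set T)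
    (f g : T -> 'rV[R]_n) :
  measurable_fun D f -> measurable_fun D g ->
  measurable_fun D (fun x => dotp (f x) (g x)).
Proof.
move=> mf mg; apply: measurable_sum => i.
by apply: measurable_funM; exact: measurableT_comp (measurable_coord i) _.
Qed.

Lemma dotp_rV_cons n (p : R * 'rV[R]_n) (w : 'rV[R]_n.+1) :
  dotp (rV_cons p) w =
  p.1 * w ord0 ord0 + dotp p.2 (\row_i w ord0 (lift ord0 i)).
Proof.
rewrite /dotp big_ord_recl rV_cons0; congr (_ + _).
by apply: eq_bigr => i _; rewrite rV_consS mxE.
Qed.

Lemma rV_consB n (p : R * 'rV[R]_n) (w : 'rV[R]_n.+1) :
  rV_cons p - w =
  rV_cons (p.1 - w ord0 ord0, p.2 - \row_i w ord0 (lift ord0 i)).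
Proof.
apply/rowP => j; rewrite [LHS]mxE.
by case: (unliftP ord0 j) => [i ->|->]; rewrite ?rV_cons0 ?rV_consS/= !mxE.
Qed.

Lemma dotpC n (x y : 'rV[R]_n) : dotp x y = dotp y x.
Proof. by apply: eq_bigr => i _; rewrite mulrC. Qed.

Lemma dotp_ge0 n (x : 'rV[R]_n) : 0 <= dotp x x.
Proof. by apply: sumr_ge0 => i _; rewrite -expr2 sqr_ge0. Qed.

Local Open Scope ereal_scope.

(** The measure on the left is the image of a product measure under [rV_cons]: change variables,
    then apply Tonelli's theorem. *)
Lemma ge0_integral_lebesgue_rVS n (f : 'rV[R]_n.+1 -> \bar R) :
  measurable_fun setT f -> (forall v, 0 <= f v) ->
  \int[lebesgue_rV n.+1]_v f v =
  \int[lebesgue_measure]_x \int[lebesgue_rV n]_v f (rV_cons (x, v)).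
Proof.
move=> mf f0.
have mcons := @measurable_rV_cons R n.
pose nu : {measure set (measurableTypeR R * 'rV[R]_n) -> \bar R} :=
  (@lebesgue_measure R \x lebesgue_rV n).
have := @ge0_integral_pushforward _ _ (measurableTypeR R * 'rV[R]_n)%type
  'rV[R]_n.+1 R (@rV_cons R n) mcons nu setT f measurableT mf.
move=> /(_ (fun v _ => f0 v)) => E.
apply: (eq_trans E); rewrite preimage_setT fubini_tonelli1//.
- exact: measurableT_comp mf mcons.
- by move=> p; exact: f0.
Qed.

End row_vectors.

(** * Centred Gaussian densities in n dimensions and their cosine transforms *)

Section gaussian_rV.
Context {R : realType}.

(** The density of [n] independent centred normal variables of standard deviation [s]. *)
Definition gauss_rV n (s : R) (v : 'rV[R]_n) : R :=
  normal_peak s ^+ n * expR (- (dotp v v / (s ^+ 2 * 2))).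

Lemma gauss_rV_ge0 n (s : R) (v : 'rV[R]_n) : 0 <= gauss_rV s v.
Proof. by rewrite mulr_ge0 ?expR_ge0// exprn_ge0 ?normal_peak_ge0. Qed.

Lemma measurable_gauss_rV n (s : R) d (T : measurableType d) (D : set T)
    (f : T -> 'rV[R]_n) :
  measurable_fun D f -> measurable_fun D (fun x => gauss_rV s (f x)).
Proof.
move=> mf; apply: measurable_funM => //; apply: measurableT_comp => //.
apply: measurableT_comp => //; apply: measurable_funM => //.
exact: measurable_dotp.
Qed.

Lemma gauss_rV_cons n (s x m : R) (v : 'rV[R]_n) : s != 0 ->
  gauss_rV s (rV_cons (x - m, v)) = normal_pdf m s x * gauss_rV s v.
Proof.
move=> s0; rewrite normal_pdfE// /normal_fun /gauss_rV dotp_rV_cons /= rV_cons0.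
rewrite exprS mulrACA -expRD; congr (_ * expR _).
rewrite (_ : \row_i _ = v); last by apply/rowP => i; rewrite mxE rV_consS.
by rewrite /=; field.
Qed.

Lemma integral_normal_pdf_cos (m s t z a c : R) : s != 0 ->
  (\int[lebesgue_measure]_x
    (normal_pdf m s x * (a + c * cos (t + z * (x - m))))%:E =
  (a + c * (cos t * expR (- (s ^+ 2 * z ^+ 2 / 2))))%:E)%E.
Proof.
move=> s0; rewrite -(normal_charfun m)//.
have ip := @integrable_normal_pdf _ m s.
have ic := integrable_normal_cos m s t z.
under eq_integral do rewrite mulrDr mulrCA (mulrC _ a) EFinD.
rewrite integralD//; [|exact: integrable_EFinZl..].
under eq_integral do rewrite EFinM.
rewrite integralZl// integral_normal_pdf mule1.
under eq_integral do rewrite EFinM.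
by rewrite integralZl// EFinD (EFinM c) /Rintegral fineK// integrable_fin_num.
Qed.

Lemma measurable_gauss_rV_cos n (s t a c : R) (z m : 'rV[R]_n) :
  measurable_fun setT
    (fun x : 'rV[R]_n => gauss_rV s (x - m) * (a + c * cos (t + dotp z (x - m)))).
Proof.
apply: measurable_funM; first by apply: measurable_gauss_rV; exact: measurable_rVB.
apply: measurable_funD => //; apply: measurable_funM => //.
apply: measurableT_comp.
  by apply: continuous_measurable_fun; exact: continuous_cos.
apply: measurable_funD => //; apply: measurable_dotp => //.
exact: measurable_rVB.
Qed.

(** Induction on the dimension. The condition on [c] keeps the integrand nonnegative, so that
    Tonelli's theorem applies. In the inner integral the phase [t] takes up the first coordinate; in
    the outer one [c] takes up the damping factor of the other coordinates. *)
Lemma integral_gauss_rV_cos n (s t a c : R) (m z : 'rV[R]_n) :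
  s != 0 -> `|c| <= a ->
  (\int[lebesgue_rV n]_x
    (gauss_rV s (x - m) * (a + c * cos (t + dotp z (x - m))))%:E =
  (a + c * (cos t * expR (- (s ^+ 2 * dotp z z / 2))))%:E)%E.
Proof.
move=> s0; elim: n m z t a c => [|n IH] m z t a c ca.
  rewrite /= integral_dirac//; last first.
    by apply/measurable_EFinP; exact: measurable_gauss_rV_cos.
  rewrite diracE in_setT mul1e; congr EFin.
  rewrite /gauss_rV /dotp !big_ord0 !mul0r !mulr0 mul0r oppr0 expR0.
  by rewrite expr0 addr0 !mulr1 mul1r.
have h0 (u : R) : 0 <= a + c * cos u.
  have : `|c * cos u| <= a.
    by rewrite normrM (le_trans _ ca)// ler_piMr// cos_max.
  by rewrite ler_norml => /andP[]; lra.
rewrite ge0_integral_lebesgue_rVS; last 2 first.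
- by apply/measurable_EFinP; exact: measurable_gauss_rV_cos.
- by move=> v; rewrite lee_fin mulr_ge0 ?gauss_rV_ge0.
pose m' : 'rV[R]_n := \row_i m ord0 (lift ord0 i).
pose z' : 'rV[R]_n := \row_i z ord0 (lift ord0 i).
pose x0 := m ord0 ord0; pose z0 := z ord0 ord0.
transitivity (\int[lebesgue_measure]_x (normal_pdf x0 s x *
    (a + (c * expR (- (s ^+ 2 * dotp z' z' / 2))) * cos (t + z0 * (x - x0))))%:E)%E.
  apply: eq_integral => x _.
  transitivity ((normal_pdf x0 s x)%:E * \int[lebesgue_rV n]_v
    (gauss_rV s (v - m') * (a + c * cos ((t + z0 * (x - x0)) + dotp z' (v - m'))))%:E)%E.
    rewrite -ge0_integralZl//.
    - apply: eq_integral => v _; rewrite -EFinM rV_consB/= gauss_rV_cons// -mulrA.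
      by rewrite (dotpC z) dotp_rV_cons/= (mulrC _ z0) (dotpC _ z') addrA.
    - by apply/measurable_EFinP; exact: measurable_gauss_rV_cos.
    - by move=> v _; rewrite lee_fin mulr_ge0 ?gauss_rV_ge0.
    - by rewrite lee_fin normal_pdf_ge0.
  by rewrite IH// -EFinM; congr (_ * (_ + _))%:E; ring.
rewrite integral_normal_pdf_cos//; congr (_ + _)%:E.
rewrite -mulrA; congr (c * _); rewrite mulrCA -expRD; congr (_ * expR _).
rewrite /dotp big_ord_recl; under eq_bigr do rewrite !mxE.
by rewrite -/z0; set S := \sum_(i < n) _; field.
Qed.

Lemma integral_gauss_rV n (s : R) (m : 'rV[R]_n) : s != 0 ->
  (\int[lebesgue_rV n]_x (gauss_rV s (x - m))%:E = 1)%E.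
Proof.
move=> s0; have := @integral_gauss_rV_cos n s 0 1 0 m 0 s0.
rewrite normr0 => /(_ ler01); rewrite mul0r addr0 => <-.
by apply: eq_integral => x _; rewrite mul0r addr0 mulr1.
Qed.

End gaussian_rV.

(** * Gamma integrals *)

Section subordination.
Context {R : realType}.
Local Notation leb := (@lebesgue_measure R).

Lemma ge0_integral_translation (G : R -> R) (d : R) :
  continuous G -> (forall x, 0 <= G x) ->
  (\int[leb]_x (G (x + d))%:E = \int[leb]_x (G x)%:E)%E.
Proof.
move=> cG G0; pose F (x : R) := x + d.
have F' : F^`()%classic = cst 1.
  apply/funext => x; rewrite derive1E /F deriveD//.
  by rewrite derive_id derive_cst addr0.
rewrite [RHS](@increasing_ge0_integration_by_substitutionT _ F)//.
- by apply: eq_integral => x _; rewrite F' fctE mulr1.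
- by move=> x y xy; rewrite /F ltrD2r.
- by rewrite F'; move=> x; exact: cvg_cst.
- by rewrite F'; exact: is_cvg_cst.
- by rewrite F'; exact: is_cvg_cst.
- apply/cvgrNyPle => A; near=> x; rewrite /F -lerBrDr.
  by near: x; apply: nbhs_ninfty_le; exact: num_real.
- apply/cvgryPge => A; near=> x; rewrite /F -lerBlDr.
  by near: x; apply: nbhs_pinfty_ge; exact: num_real.
Unshelve. all: by end_near. Qed.

(* With [e = 1] or [e = -1] and the substitution [s = expR (e * u)], this is
   the Gamma integral of [s `^ (a - 1) * expR (- (s * r))] over [s > 0]. *)
Definition gamma_fun (a e r u : R) : R :=
  expR (a * (e * u)) * expR (- (expR (e * u) * r)).

Lemma gamma_fun_ge0 a e r u : 0 <= gamma_fun a e r u.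
Proof. by rewrite mulr_ge0 ?expR_ge0. Qed.

Lemma continuous_gamma_fun a e r : continuous (gamma_fun a e r).
Proof.
have cl (b : R) : continuous (fun u : R => b * u).
  by move=> x; apply: cvgM; [exact: cvg_cst|exact: cvg_id].
have ce : continuous (fun u => expR (e * u)).
  by move=> x; apply: continuous_comp; [exact: cl|exact: continuous_expR].
move=> x; apply: cvgM.
  apply: continuous_comp; last exact: continuous_expR.
  by apply: cvgM; [exact: cvg_cst|exact: cl].
apply: continuous_comp; last exact: continuous_expR.
by apply: cvgN; apply: cvgM; [exact: ce|exact: cvg_cst].
Qed.

(** For [a > 0] and [e] equal to [1] or [-1] this is Euler's Gamma function at [a]; only its
    positivity and its finiteness matter below. *)
Definition gamma_int (a e : R) : \bar R := (\int[leb]_u (gamma_fun a e 1 u)%:E)%E.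

Lemma integral_gamma_fun (a e r : R) : e ^+ 2 = 1 -> 0 < r ->
  (\int[leb]_u (gamma_fun a e r u)%:E = (r `^ (- a))%:E * gamma_int a e)%E.
Proof.
move=> e1 r0; rewrite /gamma_int.
(* Scaling [s = expR (e * u)] by [r] amounts to translating [u] by [e * ln r], because
   [e ^+ 2 = 1]. *)
rewrite -[X in (_ * X)%E](@ge0_integral_translation _ (e * ln r)); last 2 first.
- exact: continuous_gamma_fun.
- exact: gamma_fun_ge0.
rewrite -ge0_integralZl//.
- apply: eq_integral => u _; rewrite -EFinM /gamma_fun; congr EFin.
  rewrite !mulrDr !(mulrA e e) -expr2 e1 !mul1r !expRD lnK// mulr1.
  rewrite (_ : expR (a * ln r) = r `^ a); last by rewrite /powR gt_eqF.
  have ra0 : r `^ a != 0 by rewrite gt_eqF// powR_gt0.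
  by rewrite powRN; field.
- apply/measurable_EFinP; apply: continuous_measurable_fun => u.
  apply: (@continuous_comp _ _ _ (fun u => u + e * ln r)).
    by apply: cvgD; [exact: cvg_id|exact: cvg_cst].
  exact: continuous_gamma_fun.
- by move=> u _; rewrite lee_fin gamma_fun_ge0.
- by rewrite lee_fin powR_ge0.
Qed.

(** The integrand is at most a constant times [expR (- (a * |x|))], whose integral is twice that of
    a multiple of an exponential density. *)
Lemma gamma_int_lty (a e : R) : 0 < a -> e ^+ 2 = 1 -> (gamma_int a e < +oo)%E.
Proof.
move=> a0 e1.
pose g (x : R) := expR (- (a * `|x|)).
have cg : continuous g.
  move=> x; apply: continuous_comp; last exact: continuous_expR.
  by apply: cvgN; apply: cvgM; [exact: cvg_cst|exact: norm_continuous].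
have gfin : (\int[leb]_x (g x)%:E < +oo)%E.
  rewrite ge0_symfun_integralT//; last 2 first.
  - by move=> x; exact: expR_ge0.
  - by move=> x; rewrite /g/= normrN.
  rewrite lte_mul_pinfty//.
  have mp : measurable_fun setT (fun x => (a^-1 * exponential_pdf a x)%:E).
    apply/measurable_EFinP; apply: measurable_funM => //.
    exact: measurable_exponential_pdf.
  apply: (@le_lt_trans _ _ (\int[leb]_x (a^-1 * exponential_pdf a x)%:E)%E).
    rewrite [leLHS](_ : _ = \int[leb]_(x in [set x | (0 <= x)%R])
        (a^-1 * exponential_pdf a x)%:E)%E.
      apply: ge0_subset_integral => //.
        by rewrite -set_itvcy.
      by move=> x _; rewrite lee_fin mulr_ge0 ?invr_ge0 ?exponential_pdf_ge0 ?ltW.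
    apply: eq_integral => x; rewrite inE/= => x0.
    by rewrite exponential_pdfE// mulKf ?gt_eqF// /g ger0_norm// mulNr.
  under eq_integral do rewrite EFinM.
  rewrite ge0_integralZl//.
  - by rewrite integral_exponential_pdf// mule1 ltry.
  - by apply/measurable_EFinP; exact: measurable_exponential_pdf.
  - by move=> x _; rewrite lee_fin exponential_pdf_ge0// ltW.
  - by rewrite lee_fin invr_ge0 ltW.
pose C := expR (4 * a ^+ 2).
have mg : measurable_fun setT (EFin \o g).
  by apply/measurable_EFinP; exact: continuous_measurable_fun.
apply: (@le_lt_trans _ _ (\int[leb]_x (C * g x)%:E)%E).
  apply: ge0_le_integral => //.
  - by move=> x _; rewrite lee_fin gamma_fun_ge0.
  - apply/measurable_EFinP; apply: continuous_measurable_fun.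
    exact: continuous_gamma_fun.
  - by apply/measurable_EFinP; apply: measurable_funM => //; exact/measurable_EFinP.
  - move=> x _; rewrite lee_fin /gamma_fun mulr1 -expRD -expRD ler_expR.
    have -> : `|x| = `|e * x|.
      by rewrite -sqrtr_sqr -[RHS]sqrtr_sqr exprMn e1 mul1r.
    set y := e * x.
    have [y0|y0] := leP y 0.
      by rewrite (ler0_norm y0); have := expR_gt0 y; nra.
    rewrite (gtr0_norm y0).
    have : expR y = expR (y / 2) ^+ 2.
      by rewrite -expRM_natl; congr expR; field.
    (* As [expR y] is at least [(1 + y / 2) ^+ 2], the second square yields
       [2 * a * y <= 4 * a ^+ 2 + expR y], whence the exponent in [C]. *)
    have := expR_ge1Dx (y / 2); have : 0 <= (y / 2 - 2 * a) ^+ 2 by exact: sqr_ge0.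
    by nra.
under eq_integral do rewrite EFinM.
rewrite ge0_integralZl//.
- by rewrite lte_mul_pinfty// lee_fin expR_ge0.
- by move=> x _; rewrite lee_fin expR_ge0.
- by rewrite lee_fin expR_ge0.
Qed.

(** On [[0, 1]] one has [|e * u| <= 1]; the constant [c] takes the worst case [-1] in the first
    exponential and [1] in the second. *)
Lemma gamma_int_gt0 (a e : R) : 0 < a -> e ^+ 2 = 1 -> (0 < gamma_int a e)%E.
Proof.
move=> a0 e1; pose c := expR (- a) * expR (- expR 1).
have c0 : 0 < c by rewrite mulr_gt0 ?expR_gt0.
apply: (@lt_le_trans _ _ (\int[leb]_(u in `[0%R, 1%R]) c%:E)%E).
  by rewrite integral_cst//= lebesgue_measure_itv/= lte_fin ltr01 oppr0 adde0 mule1 lte_fin.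
apply: (@le_trans _ _ (\int[leb]_(u in `[0%R, 1%R]) (gamma_fun a e 1 u)%:E)%E).
  apply: ge0_le_integral => //.
  - by move=> *; rewrite lee_fin ltW.
  - apply/measurable_EFinP; apply: measurable_funTS.
    apply: continuous_measurable_fun; exact: continuous_gamma_fun.
  - move=> u; rewrite /= in_itv/= => /andP[u0 u1].
    have : `|e * u| <= 1.
      rewrite -sqrtr_sqr exprMn e1 mul1r sqrtr_sqr ger0_norm//.
    rewrite ler_norml => /andP[eu1 eu2].
    rewrite lee_fin /gamma_fun mulr1 ler_pM ?expR_ge0// ler_expR; first by nra.
    by rewrite lerN2 ler_expR.
apply: ge0_subset_integral => //.
  apply/measurable_EFinP; apply: continuous_measurable_fun.
  exact: continuous_gamma_fun.
by move=> u _; rewrite lee_fin gamma_fun_ge0.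
Qed.

(** Without damping the integrand is at least [1] on a half-line. This produces the value [+oo] of
    the Riesz kernel at the origin. *)
Lemma integral_gamma_fun0 (a : R) : 0 < a ->
  (\int[leb]_u (gamma_fun a 1 0 u)%:E = +oo)%E.
Proof.
move=> a0; apply/eqP; rewrite eq_le leey/=.
rewrite [leLHS](_ : _ = \int[leb]_(u in `[0%R, +oo[) (cst 1 u))%E; last first.
  by rewrite integral_cst//= mul1e lebesgue_measure_itv/= ltry oppr0 adde0.
apply: (@le_trans _ _ (\int[leb]_(u in `[0%R, +oo[) (gamma_fun a 1 0 u)%:E)%E).
  apply: ge0_le_integral => //.
  - apply/measurable_EFinP; apply: measurable_funTS.
    apply: continuous_measurable_fun; exact: continuous_gamma_fun.
  - move=> u; rewrite /= in_itv/= andbT => u0.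
    rewrite lee_fin /gamma_fun mulr0 oppr0 expR0 mulr1 mul1r -expR0 ler_expR.
    by rewrite mulr_ge0// ltW.
apply: ge0_subset_integral => //.
  apply/measurable_EFinP; apply: continuous_measurable_fun.
  exact: continuous_gamma_fun.
by move=> u _; rewrite lee_fin gamma_fun_ge0.
Qed.

End subordination.

(** * Functions vanishing at infinity *)

Section C_infty.
Context {R : realType} {n : nat}.
Implicit Types f h : 'rV[R]_n -> R.

(** At a point of discontinuity, the balls of radius [j.+1%:R^-1] provide a sequence that
    contradicts the hypothesis. *)
Lemma sequential_continuous f :
  (forall (x : 'rV[R]_n) (y : nat -> 'rV[R]_n),
    y j @[j --> \oo] --> x -> f (y j) @[j --> \oo] --> f x) ->
  continuous f.
Proof.
move=> fs x; apply/(@cvgrPdist_lt _ _ _ _ (nbhs_filter x)) => e e0; apply: contrapT => nfe.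
have /choice[y yP] (j : nat) :
    exists y, `|x - y| < j.+1%:R^-1 /\ e <= `|f x - f y|.
  apply: contrapT => /forallNP yj; apply: nfe.
  apply/nbhs_ballP; exists j.+1%:R^-1; rewrite /= ?invr_gt0// => y.
  rewrite -ball_normE/= => xy; rewrite ltNge; apply/negP => fe.
  by apply: (yj y); split.
have yx : y j @[j --> \oo] --> x.
  apply/cvgrPdist_lt => d d0; near=> j.
  rewrite (lt_trans (yP j).1)//; near: j.
  exact: near_infty_natSinv_lt (PosNum d0).
have /cvgrPdist_lt/(_ _ e0) := fs _ _ yx.
move=> [N _ /(_ N (leqnn _))] /=.
by rewrite ltNge (yP N).2.
Unshelve. all: by end_near. Qed.

(** Both requirements are put in sequential form, the form in which dominated convergence delivers
    them. *)
Lemma C_infty_seq f :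
  (forall (x : 'rV[R]_n) (y : nat -> 'rV[R]_n),
    y j @[j --> \oo] --> x -> f (y j) @[j --> \oo] --> f x) ->
  (forall y : nat -> 'rV[R]_n, (forall j, j%:R <= enorm (y j)) ->
    f (y j) @[j --> \oo] --> 0) ->
  C_infty f.
Proof.
move=> fc f0; split; first exact: sequential_continuous.
move=> e e0; apply: contrapT => /forallNP nM.
have /choice[y yP] (j : nat) :
    exists y, j%:R <= enorm y /\ e <= `|f y|.
  apply: contrapT => /forallNP yj; apply: (nM j%:R) => y jy.
  by rewrite ltNge; apply/negP => fe; apply: (yj y).
have /cvgrPdist_lt/(_ _ e0) := f0 y (fun j => (yP j).1).
move=> [N _ /(_ N (leqnn _))] /=.
by rewrite sub0r normrN ltNge (yP N).2.
Qed.

Lemma C_infty_unif_lim f :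
  (forall e, 0 < e -> exists2 h, C_infty h & forall x, `|f x - h x| <= e) ->
  C_infty f.
Proof.
move=> fh; split=> [x|e e0].
  apply/(@cvgrPdist_lt _ _ _ _ (nbhs_filter x)) => e e0.
  have [h [ch _] fhe] := fh (e / 4) (divr_gt0 e0 (ltr0n _ 4)).
  have /(@cvgrPdist_lt _ _ _ _ (nbhs_filter x))/(_ (e / 4) (divr_gt0 e0 (ltr0n _ 4))) := ch x.
  apply: (@filterS _ _ (nbhs_filter x)) => y hxy.
  have := fhe x; have := fhe y; move: hxy; rewrite ltr_norml !ler_norml ltr_norml.
  by move=> /andP[? ?] /andP[? ?] /andP[? ?]; apply/andP; split; lra.
have [h [_ ch] fhe] := fh (e / 4) (divr_gt0 e0 (ltr0n _ 4)).
have [M hM] := ch (e / 4) (divr_gt0 e0 (ltr0n _ 4)).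
exists M => x /hM; have := fhe x; rewrite !ltr_norml ler_norml.
by move=> /andP[? ?] /andP[? ?]; apply/andP; split; lra.
Qed.

Lemma C_infty_scale (k : R) f : C_infty f -> C_infty (fun x => k * f x).
Proof.
move=> [cf f0]; split=> [x|e e0].
  by apply: continuousM; [exact: cst_continuous|exact: cf].
have k0 : 0 < `|k| + 1 by rewrite ltr_wpDl.
have [M fM] := f0 (e / (`|k| + 1)) (divr_gt0 e0 k0).
exists M => x /fM; rewrite ltr_pdivlMr// normrM; apply: le_lt_trans.
by rewrite mulrC ler_wpM2l// lerDl.
Qed.

Lemma C_infty_integral d (T : measurableType d) (nu : {measure set T -> \bar R})
    (K : T -> 'rV[R]_n -> R) (g : T -> \bar R) :
  (forall t, C_infty (K t)) ->
  (forall x, measurable_fun setT (K^~ x)) ->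
  nu.-integrable setT g ->
  (forall t x, (`|K t x|%:E <= g t)%E) ->
  C_infty (fun x => \int[nu]_t K t x).
Proof.
move=> KC mK ig Kg.
(* One limit theorem serves twice: with [l = K^~ x] for continuity, and with [l = 0] for sequences
   that go to infinity. *)
have dom (y : nat -> 'rV[R]_n) (l : T -> R) :
    (forall t, K t (y j) @[j --> \oo] --> l t) ->
    \int[nu]_t K t (y j) @[j --> \oo] --> \int[nu]_t l t.
  move=> Kl.
  have ml : measurable_fun setT l.
    by apply: (measurable_fun_cvg (fun j => mK (y j))) => t _; exact: Kl.
  have mK' j : measurable_fun setT (fun t => (K t (y j))%:E).
    exact/measurable_EFinP.
  have ml' : measurable_fun setT (EFin \o l) by exact/measurable_EFinP.
  have Kl' : {ae nu, forall t, setT t ->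
      (K t (y j))%:E @[j --> \oo] --> (EFin \o l) t}.
    by apply: aeW => t _; apply: cvg_EFin; [exact: nearW|exact: Kl].
  have Kg' : {ae nu, forall t j, setT t -> (`|(K t (y j))%:E| <= g t)%E}.
    by apply: aeW => t j _; exact: Kg.
  have [il _ cI] := dominated_convergence measurableT mK' ml' Kl' ig Kg'.
  apply: fine_cvg; rewrite /Rintegral fineK//.
  exact: integrable_fin_num.
apply: C_infty_seq => [x y yx|y yoo].
  apply: dom => t; have [cK _] := KC t.
  exact: (cvg_comp _ _ yx (cK x)).
rewrite (_ : 0 = \int[nu]_t (cst 0) t); last by rewrite Rintegral_cst// mul0r.
apply: dom => t; have [_ K0] := KC t.
apply/cvgrPdist_lt => e /K0[M KM].
near=> j; rewrite sub0r normrN; apply: KM.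
apply: le_trans (yoo j); near: j; exact: nbhs_infty_ger.
Unshelve. all: by end_near. Qed.

Lemma continuous_sumr (T : topologicalType) (I : Type) (s : seq I)
    (F : I -> T -> R) : (forall i, continuous (F i)) ->
  continuous (fun x => \sum_(i <- s) F i x).
Proof.
move=> cF; elim: s => [|i s IH].
  rewrite (_ : (fun _ => _) = cst 0); first exact: cst_continuous.
  by apply/funext => x; rewrite big_nil.
rewrite (_ : (fun _ => _) = F i \+ (fun x => \sum_(i <- s) F i x)).
  by move=> x; apply: (@continuousD _ R); [exact: cF|exact: IH].
by apply/funext => x; rewrite big_cons.
Qed.

Lemma continuous_dotp (y : 'rV[R]_n) :
  continuous (fun x : 'rV[R]_n => dotp (x - y) (x - y)).
Proof.
apply: continuous_sumr => i x.
have ci : {for x, continuous (fun v : 'rV[R]_n => (v - y) ord0 i)}.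
  rewrite (_ : (fun _ => _) = (fun v : 'rV[R]_n => v ord0 i - y ord0 i)).
    apply: (@continuousB _ R); last exact: cst_continuous.
    exact: coord_continuous.
  by apply/funext => v; rewrite !mxE.
exact: continuousM.
Qed.

Lemma dotp_le2 (x y : 'rV[R]_n) :
  dotp x x <= 2 * dotp (x - y) (x - y) + 2 * dotp y y.
Proof.
rewrite /dotp !mulr_sumr -big_split/=; apply: ler_sum => i _.
rewrite !mxE; have : 0 <= (x ord0 i - 2 * y ord0 i) ^+ 2 by exact: sqr_ge0.
by nra.
Qed.

Lemma C_infty_gaussian (c : R) (y : 'rV[R]_n) : 0 < c ->
  C_infty (fun x : 'rV[R]_n => expR (- (c * dotp (x - y) (x - y)))).
Proof.
move=> c0; split=> [x|e e0].
  apply: continuous_comp; last exact: continuous_expR.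
  apply: (@continuousN _ R); apply: continuousM; first exact: cst_continuous.
  exact: continuous_dotp.
(* The summand [1] makes the square of the norm at least the bound itself. Then [dotp_le2] gives
   [|x - y|^2 >= 1 / (c * e)], and [expR v >= 1 + v] does the rest. *)
exists (1 + 2 * dotp y y + 2 / (c * e)) => x Mx.
rewrite ger0_norm ?expR_ge0//.
have y0 := dotp_ge0 y.
have ce0 : 0 < 2 / (c * e) by rewrite divr_gt0// mulr_gt0.
have xx : enorm x ^+ 2 = dotp x x by rewrite sqr_sqrtr// dotp_ge0.
have xM : 2 * dotp y y + 2 / (c * e) <= dotp x x by rewrite -xx; nra.
have := dotp_le2 x y; set D := dotp (x - y) _ => xD.
have cD : e^-1 <= c * D.
  have -> : e^-1 = c * (c * e)^-1 by rewrite invfM mulrA divff ?mul1r// gt_eqF.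
  by apply: ler_wpM2l; [exact: ltW|lra].
rewrite expRN -[ltRHS]invrK ltf_pV2 ?posrE ?invr_gt0 ?expR_gt0//.
by apply: le_lt_trans cD _; have := expR_ge1Dx (c * D); lra.
Qed.

End C_infty.

(** * Gaussian convolutions of a finite measure *)

Section fourier_gauss.
Context {R : realType} {n : nat}.
Variable mu : {finite_measure set 'rV[R]_n -> \bar R}.
Local Notation mass := (fine (mu setT)).

(** The real part of [expi (dotp x xi)] times the conjugate of [fourier mu xi], that is, the
    integrand of the inversion formula in real form. *)
Definition cosint (x xi : 'rV[R]_n) : R := \int[mu]_y cos (dotp xi (x - y)).

Lemma finite_mass : mu setT = mass%:E.
Proof. by rewrite fineK// fin_num_measure. Qed.

Lemma integrable_bounded (f : 'rV[R]_n -> R) (C : R) :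
  measurable_fun setT f -> (forall y, `|f y| <= C) ->
  mu.-integrable setT (EFin \o f).
Proof.
move=> mf fC; apply: measurable_bounded_integrable => //.
  by rewrite -ge0_fin_numE// fin_num_measure.
exists C; split; first exact: num_real.
by move=> M CM y _ /=; rewrite (le_trans (fC y))// ltW.
Qed.

Lemma measurable_cos_dotp d (T : measurableType d) (D : set T)
    (f g : T -> 'rV[R]_n) : measurable_fun D f -> measurable_fun D g ->
  measurable_fun D (fun x => cos (dotp (f x) (g x))).
Proof.
move=> mf mg; apply: measurableT_comp; last exact: measurable_dotp.
by apply: continuous_measurable_fun; exact: continuous_cos.
Qed.

Lemma measurable_sin_dotp d (T : measurableType d) (D : set T)
    (f g : T -> 'rV[R]_n) : measurable_fun D f -> measurable_fun D g ->
  measurable_fun D (fun x => sin (dotp (f x) (g x))).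
Proof.
move=> mf mg; apply: measurableT_comp; last exact: measurable_dotp.
by apply: continuous_measurable_fun; exact: continuous_sin.
Qed.

Lemma normc_fourierE (xi : 'rV[R]_n) :
  Normc.normc (fourier mu xi) =
  Num.sqrt ((\int[mu]_y cos (dotp y xi)) ^+ 2 + (\int[mu]_y sin (dotp y xi)) ^+ 2).
Proof. by []. Qed.

Lemma cosintE (x xi : 'rV[R]_n) :
  cosint x xi = cos (dotp x xi) * \int[mu]_y cos (dotp y xi)
              + sin (dotp x xi) * \int[mu]_y sin (dotp y xi).
Proof.
have ic : mu.-integrable setT (EFin \o (fun y => cos (dotp y xi))).
  by apply: (@integrable_bounded _ 1) => [|y]; [exact: measurable_cos_dotp|exact: cos_max].
have is_ : mu.-integrable setT (EFin \o (fun y => sin (dotp y xi))).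
  by apply: (@integrable_bounded _ 1) => [|y]; [exact: measurable_sin_dotp|exact: sin_max].
rewrite -!RintegralZl// -RintegralD//; [|exact: integrable_EFinZl..].
apply: eq_Rintegral => y _; rewrite -cosB; congr cos.
rewrite dotpC /dotp -sumrB; apply: eq_bigr => i _.
by rewrite !mxE mulrBl.
Qed.

(** Cauchy-Schwarz in the plane: the difference of the squares is the square of [c * S - s * C]. *)
Lemma cosint_le_normc (x xi : 'rV[R]_n) :
  `|cosint x xi| <= Normc.normc (fourier mu xi).
Proof.
rewrite normc_fourierE -(ler_pXn2r (n := 2)) ?nnegrE ?sqrtr_ge0//.
rewrite sqr_sqrtr ?addr_ge0 ?sqr_ge0// real_normK ?num_real// cosintE.
set C := \int[mu]_y _; set S := \int[mu]_y _.
have : 0 <= (cos (dotp x xi) * S - sin (dotp x xi) * C) ^+ 2 by exact: sqr_ge0.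
have := cos2Dsin2 (dotp x xi); set c := cos _; set s := sin _ => cs.
have -> : C ^+ 2 + S ^+ 2 = (c ^+ 2 + s ^+ 2) * (C ^+ 2 + S ^+ 2) by rewrite cs mul1r.
by nra.
Qed.

(* Adding the constant [1] makes the integrand nonnegative, so that Tonelli's
   theorem applies. *)
Lemma onePcos_ge0 (t : R) : 0 <= 1 + cos t.
Proof. by have := cos_geN1 t; lra. Qed.

Lemma integral_onePcos (x xi : 'rV[R]_n) :
  (\int[mu]_y (1 + cos (dotp xi (x - y)))%:E = (mass + cosint x xi)%:E)%E.
Proof.
have ic : mu.-integrable setT (fun y => (cos (dotp xi (x - y)))%:E).
  apply: (@integrable_bounded _ 1) => [|y]; last exact: cos_max.
  by apply: measurable_cos_dotp => //; exact: measurable_rVB.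
have i1 : mu.-integrable setT (cst 1%E).
  by apply: (@integrable_bounded (cst 1) 1) => // y; rewrite normr1.
under eq_integral do rewrite EFinD.
rewrite integralD// integral_cst// mul1e EFinD.
congr (_ + _)%E; first exact: finite_mass.
by rewrite /cosint /Rintegral fineK//; exact: integrable_fin_num.
Qed.

(** Tonelli's theorem gives measurability for the nonnegative [1 + f]; the mass of [mu] is then
    subtracted. *)
Lemma measurable_Rintegral_param d (T : measurableType d)
    (f : T * 'rV[R]_n -> R) : measurable_fun setT f -> (forall p, `|f p| <= 1) ->
  measurable_fun setT (fun t => \int[mu]_y f (t, y)).
Proof.
move=> mf f1; have mft t : measurable_fun setT (fun y => f (t, y)).
  exact: measurableT_comp mf (pair1_measurable t).
rewrite (_ : (fun _ => _) = fun t =>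
    fine (\int[mu]_y (1 + f (t, y))%:E) - mass); last first.
  apply/funext => t; under [in RHS]eq_integral do rewrite EFinD.
  have i1 : mu.-integrable setT (cst 1%E).
    by apply: (@integrable_bounded (cst 1) 1) => // y; rewrite normr1.
  have ift : mu.-integrable setT (fun y => (f (t, y))%:E).
    by apply: (@integrable_bounded _ 1) => [|y]; [exact: mft|exact: f1].
  rewrite integralD// integral_cst// mul1e fineD ?fin_num_measure//.
    by rewrite addrC addKr.
  exact: integrable_fin_num.
apply: measurable_funB => //; apply: measurableT_comp => //.
apply: (@measurable_fun_fubini_tonelli_F _ _ _ _ _ mu (fun p => (1 + f p)%:E)).
- by apply/measurable_EFinP; exact: measurable_funD.
- by move=> p; rewrite lee_fin; have := f1 p; rewrite ler_norml; lra.
Qed.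

Lemma measurable_cosint (x : 'rV[R]_n) : measurable_fun setT (cosint x).
Proof.
apply: (@measurable_Rintegral_param _ _ (fun p => cos (dotp p.1 (x - p.2)))).
  by apply: measurable_cos_dotp => //; exact: measurable_rVB.
by move=> p; exact: cos_max.
Qed.

Lemma measurable_normc_fourier :
  measurable_fun setT (fun xi => Normc.normc (fourier mu xi)).
Proof.
under eq_fun do rewrite normc_fourierE.
apply: measurableT_comp; first by apply: continuous_measurable_fun; exact: sqrt_continuous.
apply: measurable_funD; apply: measurable_funX.
- apply: (@measurable_Rintegral_param _ _ (fun p => cos (dotp p.2 p.1))).
    exact: measurable_cos_dotp.
  by move=> p; exact: cos_max.
- apply: (@measurable_Rintegral_param _ _ (fun p => sin (dotp p.2 p.1))).
    exact: measurable_sin_dotp.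
  by move=> p; exact: sin_max.
Qed.

Lemma normc_fourier_ge0 xi : 0 <= Normc.normc (fourier mu xi).
Proof. by rewrite normc_fourierE sqrtr_ge0. Qed.

(** Here [s] is the standard deviation on the frequency side; as a function of [x - y] the kernel is
    an unnormalized Gaussian of standard deviation [1 / s]. *)
Definition gauss_conv (s : R) (x : 'rV[R]_n) : R :=
  \int[mu]_y expR (- (s ^+ 2 * dotp (x - y) (x - y) / 2)).

Lemma measurable_gauss_kernel (s : R) (x : 'rV[R]_n) :
  measurable_fun setT (fun y : 'rV[R]_n => expR (- (s ^+ 2 * dotp (x - y) (x - y) / 2))).
Proof.
apply: measurableT_comp => //; apply: measurableT_comp => //.
apply: measurable_funM => //; apply: measurable_funM => //.
by apply: measurable_dotp; exact: measurable_rVB.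
Qed.

Lemma gauss_kernel_le1 (s : R) (z : 'rV[R]_n) :
  `|expR (- (s ^+ 2 * dotp z z / 2))| <= 1.
Proof.
rewrite ger0_norm ?expR_ge0// -expR0 ler_expR oppr_le0.
by rewrite divr_ge0// mulr_ge0 ?sqr_ge0 ?dotp_ge0.
Qed.

(** Tonelli's theorem for the Gaussian times [1 + cos]: integrating over [xi] first is the Gaussian
    cosine transform at frequency [x - y]. The mass on either side comes from the constant [1]. *)
Lemma integral_gauss_cosint (s : R) (x : 'rV[R]_n) : s != 0 ->
  (\int[lebesgue_rV n]_xi (gauss_rV s xi * (mass + cosint x xi))%:E =
   (mass + gauss_conv s x)%:E)%E.
Proof.
move=> s0.
pose f (p : 'rV[R]_n * 'rV[R]_n) : R :=
  gauss_rV s p.1 * (1 + cos (dotp p.1 (x - p.2))).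
have mf : measurable_fun setT f.
  apply: measurable_funM; first exact: measurable_gauss_rV.
  apply: measurable_funD => //.
  by apply: measurable_cos_dotp => //; exact: measurable_rVB.
have f0 p : (0 <= (f p)%:E)%E.
  by rewrite lee_fin mulr_ge0 ?gauss_rV_ge0 ?onePcos_ge0.
transitivity (\int[lebesgue_rV n]_xi \int[mu]_y (f (xi, y))%:E)%E.
  apply: eq_integral => xi _; rewrite EFinM -integral_onePcos.
  rewrite -ge0_integralZl//.
  - apply/measurable_EFinP; apply: measurable_funD => //.
    by apply: measurable_cos_dotp => //; exact: measurable_rVB.
  - by rewrite lee_fin gauss_rV_ge0.
rewrite (@fubini_tonelli _ _ _ _ _ (lebesgue_rV n) mu (EFin \o f))//; last first.
  exact/measurable_EFinP.
transitivity (\int[mu]_y (1 + expR (- (s ^+ 2 * dotp (x - y) (x - y) / 2)))%:E)%E.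
  apply: eq_integral => y _.
  have := @integral_gauss_rV_cos R n s 0 1 1 0 (x - y) s0.
  rewrite normr1 cos0 !mul1r => /(_ (lexx _)) <-.
  apply: eq_integral => xi _; rewrite /f/= subr0 add0r mul1r.
  by rewrite (dotpC xi).
under eq_integral do rewrite EFinD.
have i1 : mu.-integrable setT (cst 1%E).
  by apply: (@integrable_bounded (cst 1) 1) => // y; rewrite normr1.
have ig : mu.-integrable setT
    (fun y => (expR (- (s ^+ 2 * dotp (x - y) (x - y) / 2)))%:E).
  apply: (@integrable_bounded _ 1) => [|y]; last exact: gauss_kernel_le1.
  exact: measurable_gauss_kernel.
rewrite integralD// integral_cst// mul1e EFinD.
congr (_ + _)%E; first exact: finite_mass.
by rewrite /gauss_conv /Rintegral fineK//; exact: integrable_fin_num.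
Qed.

Lemma integral_gauss_rV0 (s : R) : s != 0 ->
  (\int[lebesgue_rV n]_xi (gauss_rV s xi)%:E = 1)%E.
Proof.
move=> s0; rewrite -(@integral_gauss_rV _ n s 0 s0).
by apply: eq_integral => xi _; rewrite subr0.
Qed.

(** With the mass added to both sides all integrands are nonnegative and can be compared pointwise.
    The bound is the same for all [x] and may be infinite. *)
Lemma gauss_conv_le (s : R) (x : 'rV[R]_n) : s != 0 ->
  ((gauss_conv s x)%:E <= \int[lebesgue_rV n]_xi
    (gauss_rV s xi * Normc.normc (fourier mu xi))%:E)%E.
Proof.
move=> s0; have := integral_gauss_cosint x s0; rewrite EFinD => E.
rewrite -(@leeD2lE _ mass%:E)// -E.
have mg : measurable_fun setT (fun xi : 'rV[R]_n => gauss_rV s xi).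
  exact: measurable_gauss_rV.
have mM := measurable_normc_fourier.
have mass0 : 0 <= mass by rewrite fine_ge0.
rewrite [leRHS](_ : _ = \int[lebesgue_rV n]_xi
    (gauss_rV s xi * (mass + Normc.normc (fourier mu xi)))%:E)%E; last first.
  under [RHS]eq_integral do rewrite mulrDr EFinD.
  rewrite ge0_integralD//=.
  - congr (_ + _)%E; under eq_integral do rewrite mulrC EFinM.
    rewrite ge0_integralZl//.
    + by rewrite integral_gauss_rV0// mule1.
    + exact/measurable_EFinP.
    + by move=> xi _; rewrite lee_fin gauss_rV_ge0.
  - by move=> xi _; rewrite lee_fin mulr_ge0 ?gauss_rV_ge0.
  - by apply/measurable_EFinP; exact: measurable_funM.
  - by move=> xi _; rewrite lee_fin mulr_ge0 ?gauss_rV_ge0 ?normc_fourier_ge0.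
  - by apply/measurable_EFinP; exact: measurable_funM.
apply: ge0_le_integral => //.
- move=> xi _; rewrite lee_fin mulr_ge0 ?gauss_rV_ge0//.
  rewrite -lee_fin -integral_onePcos; apply: integral_ge0 => y _.
  by rewrite lee_fin onePcos_ge0.
- apply/measurable_EFinP; apply: measurable_funM => //.
  by apply: measurable_funD => //; exact: measurable_cosint.
- apply/measurable_EFinP; apply: measurable_funM => //.
  exact: measurable_funD.
- move=> xi _; rewrite lee_fin ler_wpM2l ?gauss_rV_ge0// lerD2l.
  by rewrite (le_trans (ler_norm _))// cosint_le_normc.
Qed.

Lemma C_infty_gauss_conv (s : R) : s != 0 -> C_infty (gauss_conv s).
Proof.
move=> s0; apply: (@C_infty_integral _ _ _ _ mu
    (fun y x : 'rV[R]_n => expR (- (s ^+ 2 * dotp (x - y) (x - y) / 2))) (cst 1%E)).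
- move=> y; rewrite (_ : (fun _ => _) =
      (fun x : 'rV[R]_n => expR (- (s ^+ 2 / 2 * dotp (x - y) (x - y))))).
    by apply: C_infty_gaussian; rewrite divr_gt0// exprn_even_gt0.
  by apply/funext => x; rewrite mulrAC.
- exact: measurable_gauss_kernel.
- by apply: (@integrable_bounded (cst 1) 1) => // y; rewrite normr1.
- by move=> y x; rewrite lee_fin gauss_kernel_le1.
Qed.

End fourier_gauss.

(** * Riesz potentials *)

Section riesz.
Context {R : realType} {n : nat}.
Local Notation leb := (@lebesgue_measure R).

Lemma half_sqr_powR (a r : R) : 0 < r ->
  (r ^+ 2 / 2) `^ (- a) = 2 `^ a * r `^ (- (2 * a)).
Proof.
move=> r0; rewrite /powR !gt_eqF ?divr_gt0 ?exprn_gt0// -expRD; congr expR.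
rewrite lnM ?posrE ?exprn_gt0 ?invr_gt0// lnV ?posrE// expr2 lnM ?posrE//.
by ring.
Qed.

(** The Riesz kernel as a mixture of Gaussians in [r]. Both sides are [+oo] at [r = 0], by the
    convention in [epowR]. *)
Lemma integral_gamma_fun_epowR (a r : R) : 0 < a -> 0 <= r ->
  (\int[leb]_u (gamma_fun a 1 (r ^+ 2 / 2) u)%:E =
   (2 `^ a)%:E * gamma_int a 1 * epowR r (- (2 * a)))%E.
Proof.
move=> a0; rewrite le_eqVlt => /predU1P[<-|r0].
  rewrite expr0n/= mul0r integral_gamma_fun0// /epowR eqxx oppr_lt0 mulr_gt0//.
  by rewrite gt0_muley// mule_gt0 ?gamma_int_gt0 ?lte_fin ?powR_gt0// expr1n.
rewrite integral_gamma_fun ?expr1n ?divr_gt0 ?exprn_gt0// half_sqr_powR//.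
by rewrite /epowR gt_eqF//= EFinM muleAC.
Qed.

(** The frequency-side counterpart, where the square is divided by the variance. At [r = 0] the
    right-hand side is [+oo], so the inequality needs no computation there. *)
Lemma integral_gamma_fun_epowR_le (a r : R) : 0 < a -> 0 <= r ->
  (\int[leb]_u (gamma_fun a (-1) (r ^+ 2 / 2) u)%:E <=
   (2 `^ a)%:E * gamma_int a (-1) * epowR r (- (2 * a)))%E.
Proof.
have N1 : (- 1 : R) ^+ 2 = 1 by rewrite sqrrN expr1n.
move=> a0; rewrite le_eqVlt => /predU1P[<-|r0].
  rewrite /epowR eqxx oppr_lt0 mulr_gt0//= gt0_muley ?leey//.
  by rewrite mule_gt0 ?gamma_int_gt0 ?lte_fin ?powR_gt0.
rewrite integral_gamma_fun ?divr_gt0 ?exprn_gt0// half_sqr_powR//.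
by rewrite /epowR gt_eqF//= EFinM muleAC.
Qed.

Lemma measurable_gamma_fun (a e : R) d (T : measurableType d) (D : set T)
    (f g : T -> R) : measurable_fun D f -> measurable_fun D g ->
  measurable_fun D (fun t => gamma_fun a e (f t) (g t)).
Proof.
move=> mf mg; apply: measurable_funM; apply: measurableT_comp => //.
  by apply: measurable_funM => //; exact: measurable_funM.
apply: measurableT_comp => //; apply: measurable_funM => //.
by apply: measurableT_comp => //; exact: measurable_funM.
Qed.

Lemma expR_half_sqr (u : R) : expR (u / 2) ^+ 2 = expR u.
Proof. by rewrite -expRM_natl; congr expR; field. Qed.

(** For standard deviation [s = expR (u / 2)] the weight is [s] to the power [n - 2 * b]. It cancels
    the normalization of the density and leaves a Gamma integrand, whose integral in [u] is a
    multiple of the power [- 2 * b] of the norm. *)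
Lemma gauss_rV_expR (b u : R) (xi : 'rV[R]_n) :
  expR ((n%:R / 2 - b) * u) * gauss_rV (expR (u / 2)) xi =
  normal_peak 1 ^+ n * gamma_fun b (-1) (enorm xi ^+ 2 / 2) u.
Proof.
rewrite /gauss_rV /gamma_fun sqr_sqrtr ?dotp_ge0// expR_half_sqr.
have -> : normal_peak (expR (u / 2)) = expR (- (u / 2)) * normal_peak 1.
  by rewrite normal_peakE gtr0_norm ?expR_gt0// expRN.
rewrite exprMn -expRM_natl mulN1r.
have -> : dotp xi xi / (expR u * 2) = expR (- u) * (dotp xi xi / 2).
  by rewrite expRN; have := expR_gt0 u => u0; field; rewrite gt_eqF.
have -> : (n%:R / 2 - b) * u = b * - u - n%:R * - (u / 2) by field.
rewrite expRD (expRN (n%:R * _)).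
set E := expR (n%:R * _); have E0 : E != 0 by rewrite gt_eqF ?expR_gt0.
by field.
Qed.

Variable mu : {finite_measure set 'rV[R]_n -> \bar R}.

Lemma C_infty_riesz_potential (alpha : R) : 0 < alpha < n%:R ->
  (\int[lebesgue_rV n]_xi ((Normc.normc (fourier mu xi))%:E
     * epowR (enorm xi) (- alpha)) < +oo)%E ->
  exists2 U : 'rV[R]_n -> R, C_infty U &
    riesz_potential alpha mu = EFin \o U.
Proof.
move=> /andP[alpha0 alphan] fin.
(* Half the exponents of the Riesz kernel and of the weight in the hypothesis; they add up to
   [n / 2]. *)
pose a := (n%:R - alpha) / 2; pose b := alpha / 2.
have a0 : 0 < a by rewrite divr_gt0// subr_gt0.
have b0 : 0 < b by rewrite divr_gt0.
(* The contribution of the scale [s = expR (u / 2)] to the potential, up to a constant factor. *)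
pose K (u : R) (x : 'rV[R]_n) := expR (a * u) * gauss_conv mu (expR (u / 2)) x.
have KE u x : (K u x)%:E =
    (\int[mu]_y (gamma_fun a 1 (enorm (x - y) ^+ 2 / 2) u)%:E)%E.
  have ig : mu.-integrable setT
      (fun y => (expR (- (expR (u / 2) ^+ 2 * dotp (x - y) (x - y) / 2)))%:E).
    apply: (@integrable_bounded _ _ _ _ 1) => [|y]; last exact: gauss_kernel_le1.
    exact: measurable_gauss_kernel.
  rewrite /K EFinM /gauss_conv /Rintegral fineK; last exact: integrable_fin_num.
  rewrite -ge0_integralZl//.
  - apply: eq_integral => y _; rewrite -EFinM /gamma_fun !mul1r.
    by rewrite expR_half_sqr sqr_sqrtr ?dotp_ge0// mulrA.
  - by apply/measurable_EFinP; exact: measurable_gauss_kernel.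
pose M xi := Normc.normc (fourier mu xi).
have M0 xi : 0 <= M xi := normc_fourier_ge0 mu xi.
have mM : measurable_fun setT M := measurable_normc_fourier mu.
pose k : R := normal_peak 1 ^+ n.
have k0 : 0 <= k by rewrite exprn_ge0 ?normal_peak_ge0.
pose f (p : R * 'rV[R]_n) : R :=
  k * gamma_fun b (-1) (enorm p.2 ^+ 2 / 2) p.1 * M p.2.
have f0 p : 0 <= f p by rewrite !mulr_ge0// gamma_fun_ge0.
pose g (u : R) := (\int[lebesgue_rV n]_xi (f (u, xi))%:E)%E.
have K0 u x : 0 <= K u x.
  rewrite mulr_ge0 ?expR_ge0//; apply: Rintegral_ge0 => y _.
  exact: expR_ge0.
(* The bound on [gauss_conv] removes [x], and [gauss_rV_expR] identifies the remaining weight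
   because [a = n / 2 - b]. *)
have Kg u x : (`|K u x|%:E <= g u)%E.
  rewrite ger0_norm// /K EFinM.
  have su : expR (u / 2) != 0 by rewrite gt_eqF ?expR_gt0.
  apply: (@le_trans _ _ ((expR (a * u))%:E * \int[lebesgue_rV n]_xi
      (gauss_rV (expR (u / 2)) xi * M xi)%:E)%E).
    by rewrite lee_pmul2l ?lte_fin ?expR_gt0// gauss_conv_le.
  rewrite -ge0_integralZl//.
  - rewrite le_eqVlt; apply/orP; left; apply/eqP; apply: eq_integral => xi _.
    rewrite -EFinM /f/= -gauss_rV_expR mulrA.
    by rewrite (_ : a = n%:R / 2 - b)//; rewrite /a /b; field.
  - apply/measurable_EFinP; apply: measurable_funM => //.
    exact: measurable_gauss_rV.
  - by move=> xi _; rewrite lee_fin mulr_ge0 ?gauss_rV_ge0.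
have mhalf d (T : measurableType d) (h : T -> 'rV[R]_n) :
    measurable_fun setT h -> measurable_fun setT (fun t => enorm (h t) ^+ 2 / 2).
  move=> mh; apply: measurable_funM => //.
  under eq_fun do rewrite sqr_sqrtr ?dotp_ge0//.
  exact: measurable_dotp.
have mf : measurable_fun setT f.
  apply: measurable_funM; last exact: measurableT_comp mM _.
  apply: measurable_funM => //; apply: measurable_gamma_fun => //.
  exact: mhalf.
have mG x : measurable_fun setT (fun p : R * 'rV[R]_n =>
    (gamma_fun a 1 (enorm (x - p.2) ^+ 2 / 2) p.1)%:E).
  apply/measurable_EFinP; apply: measurable_gamma_fun => //.
  by apply: mhalf; exact: measurable_rVB.
have mK x : measurable_fun setT (K^~ x).
  apply/measurable_EFinP; rewrite (_ : _ \o _ = fun u =>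
    \int[mu]_y (gamma_fun a 1 (enorm (x - y) ^+ 2 / 2) u)%:E)%E; last first.
    by apply/funext => u; exact: KE.
  apply: (@measurable_fun_fubini_tonelli_F _ _ _ _ _ mu (fun p =>
    (gamma_fun a 1 (enorm (x - p.2) ^+ 2 / 2) p.1)%:E)); first exact: mG.
  by move=> p; rewrite lee_fin gamma_fun_ge0.
have mg : measurable_fun setT g.
  apply: (@measurable_fun_fubini_tonelli_F _ _ _ _ _ (lebesgue_rV n) (EFin \o f)).
    exact/measurable_EFinP.
  by move=> p; rewrite lee_fin.
(* After exchanging the integrals, the one in [u] is bounded by a multiple of the power [- alpha] of
   [enorm xi]; what remains is [C] times the integral assumed finite. *)
have gint : leb.-integrable setT g.
  apply/integrableP; split => //.
  have g0 u : (0 <= g u)%E by apply: integral_ge0 => xi _; rewrite lee_fin.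
  under eq_integral do rewrite gee0_abs//.
  rewrite (@fubini_tonelli _ _ _ _ _ leb (lebesgue_rV n) (EFin \o f))//; last first.
    exact/measurable_EFinP.
  pose C : \bar R := (k%:E * ((2 `^ b)%:E * gamma_int b (-1)))%E.
  have N1 : (- 1 : R) ^+ 2 = 1 by rewrite sqrrN expr1n.
  have C0 : (0 <= C)%E.
    by rewrite !mule_ge0 ?lee_fin ?powR_ge0// ltW// gamma_int_gt0.
  have mI : measurable_fun setT (fun xi : 'rV[R]_n =>
      ((M xi)%:E * epowR (enorm xi) (- alpha))%E).
    apply: emeasurable_funM; first exact/measurable_EFinP.
    have me : measurable_fun setT (fun xi : 'rV[R]_n => enorm xi).
      have ms : measurable_fun setT (@Num.sqrt R).
        by apply: continuous_measurable_fun; exact: sqrt_continuous.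
      apply: (measurableT_comp ms).
      by apply: measurable_dotp; exact: measurable_id.
    apply: measurable_fun_ifT => //.
      by apply: measurable_and => //; exact: measurable_fun_eqr.
    by apply/measurable_EFinP; exact: measurableT_comp (measurable_powR _) me.
  have I0 xi : (0 <= (M xi)%:E * epowR (enorm xi) (- alpha))%E.
    rewrite mule_ge0 ?lee_fin// /epowR; case: ifP => // _.
    by rewrite lee_fin powR_ge0.
  apply: (@le_lt_trans _ _ (\int[lebesgue_rV n]_xi
      (C * ((M xi)%:E * epowR (enorm xi) (- alpha))))%E).
    apply: ge0_le_integral => //.
    - by move=> xi _; apply: integral_ge0 => u _; rewrite lee_fin.
    - apply: (@measurable_fun_fubini_tonelli_G _ _ _ _ _ leb (EFin \o f)).
        exact/measurable_EFinP.
      by move=> p; rewrite lee_fin.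
    - exact: emeasurable_funM.
    - move=> xi _; rewrite /f/=.
      under eq_integral do rewrite mulrAC EFinM.
      rewrite ge0_integralZl//.
      + have -> : - alpha = - (2 * b) by rewrite /b; field.
        rewrite /C muleACA -EFinM; apply: lee_wpmul2l.
          by rewrite lee_fin mulr_ge0.
        by apply: integral_gamma_fun_epowR_le => //; exact: sqrtr_ge0.
      + by apply/measurable_EFinP; exact: measurable_gamma_fun.
      + by move=> u _; rewrite lee_fin gamma_fun_ge0.
      + by rewrite lee_fin mulr_ge0.
  rewrite ge0_integralZl//.
  rewrite lte_mul_pinfty//.
  rewrite fin_numM// fin_numM// ge0_fin_numE ?gamma_int_lty// ltW//.
  exact: gamma_int_gt0.
have UC : C_infty (fun x => \int[leb]_u K u x).
  apply: (@C_infty_integral _ _ _ _ leb K g) => // u.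
  by apply: C_infty_scale; apply: C_infty_gauss_conv; rewrite gt_eqF ?expR_gt0.
have [G0 G1] : (0 < gamma_int a 1)%E /\ (gamma_int a 1 < +oo)%E.
  by rewrite gamma_int_gt0 ?gamma_int_lty ?expr1n.
(* The inverse of the constant in the mixture formula for the Riesz kernel. *)
pose c := (2 `^ a * fine (gamma_int a 1))^-1.
exists (fun x => c * \int[leb]_u K u x); first exact: C_infty_scale.
apply/funext => x /=; rewrite /riesz_potential EFinM.
have cE y : epowR (enorm (x - y)) (alpha - n%:R) =
    (c%:E * \int[leb]_u (gamma_fun a 1 (enorm (x - y) ^+ 2 / 2) u)%:E)%E.
  rewrite integral_gamma_fun_epowR ?sqrtr_ge0// muleA.
  rewrite -(@fineK _ (gamma_int a 1)) ?ge0_fin_numE ?ltW// -!EFinM mulVf ?mul1e.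
    by congr epowR; rewrite /a; field.
  by rewrite mulf_neq0 ?gt_eqF ?powR_gt0// fine_gt0// G0.
under eq_integral do rewrite cE.
have mF := @measurable_fun_fubini_tonelli_G _ _ _ _ _ leb _ (mG x)
  (fun p => gamma_fun_ge0 _ _ _ _).
rewrite ge0_integralZl//.
- congr (_ * _)%E.
  rewrite -(@fubini_tonelli _ _ _ _ _ leb mu _ (mG x)); last first.
    by move=> p; rewrite lee_fin gamma_fun_ge0.
  under eq_integral do rewrite -KE.
  (* Domination by [g] makes the integral in [u] finite, so the potential is real-valued at every
     point. *)
  rewrite /Rintegral fineK//; apply: integrable_fin_num => //.
  apply: (le_integrable measurableT) gint.
  - by apply/measurable_EFinP; exact: mK.
  - by move=> u _; rewrite abse_EFin (le_trans (Kg u x))// lee_abs.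
- by move=> y _; apply: integral_ge0 => u _; rewrite lee_fin gamma_fun_ge0.
- rewrite lee_fin invr_ge0 mulr_ge0 ?powR_ge0// fine_ge0// ltW//.
Qed.

End riesz.

(** * Approximation of open sets *)

Section envelope.
Context {R : realType} {n : nat}.
Implicit Types (x y : 'rV[R]_n) (A : set 'rV[R]_n).

Lemma continuous_measurable_rV (f : 'rV[R]_n -> R) :
  continuous f -> measurable_fun setT f.
Proof.
move=> cf mT; apply: (measurability _ (RGenOpens.measurableE R)) => //.
move=> _ [_ [a [b ->] <-]]; rewrite setTI; apply: open_measurable_rV.
by apply: open_comp; [move=> v _; exact: cf|exact: interval_open].
Qed.

Lemma coord_le_norm (v : 'rV[R]_n) i : `|v ord0 i| <= `|v|.
Proof.
rewrite /Num.norm/= mx_normrE.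
exact: (@le_bigmax _ _ _ 0 (fun ij => `|v ij.1 ij.2|) (ord0, i)).
Qed.

(** Links the Euclidean distance, in which Gaussians are estimated, to the balls of the topology,
    which are those of the max norm. *)
Lemma sqr_norm_le_dotp (v : 'rV[R]_n) : `|v| ^+ 2 <= dotp v v.
Proof.
have [->|v0] := eqVneq v 0; first by rewrite normr0 expr0n/= dotp_ge0.
have [|[i j] /= vE] := @mx_norm_neq0 _ _ _ v.
  by move: v0; apply: contra_neq; exact: mx_norm_eq0.
rewrite [`|v|]vE (ord1 i) real_normK ?num_real//.
rewrite /dotp (bigD1 j)//= -expr2 lerDl.
by apply: sumr_ge0 => k _; rewrite -expr2 sqr_ge0.
Qed.

(* The largest [K]-Lipschitz function below the indicator of [A]. *)
Definition lip_env A (K : R) x : R :=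
  inf [set \1_A y + K * `|x - y| | y in [set: 'rV[R]_n]].

Let indic_ge0 A y : 0 <= \1_A y :> R.
Proof. by rewrite indicE. Qed.

Lemma lip_env_le A K x y : 0 <= K -> lip_env A K x <= \1_A y + K * `|x - y|.
Proof.
move=> K0; apply: ge_inf; last by exists y.
by exists 0 => _ [z _ <-]; rewrite addr_ge0// mulr_ge0.
Qed.

Lemma le_lip_env A K x (c : R) :
  (forall y, c <= \1_A y + K * `|x - y|) -> c <= lip_env A K x.
Proof.
move=> cA; apply: lb_le_inf; first by exists (\1_A x + K * `|x - x|); exists x.
by move=> _ [z _ <-].
Qed.

Lemma lip_env_ge0 A K x : 0 <= K -> 0 <= lip_env A K x.
Proof. by move=> K0; apply: le_lip_env => y; rewrite addr_ge0// mulr_ge0. Qed.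

Lemma lip_env_le_indic A K x : 0 <= K -> lip_env A K x <= \1_A x.
Proof. by move=> K0; rewrite (le_trans (lip_env_le A x x K0))// subrr normr0 mulr0 addr0. Qed.

Lemma lip_env_lip A K x y : 0 <= K ->
  lip_env A K x <= lip_env A K y + K * `|x - y|.
Proof.
move=> K0; rewrite -lerBlDr; apply: le_lip_env => z.
rewrite lerBlDr (le_trans (lip_env_le A x z K0))// -addrA lerD2l -mulrDr.
by rewrite ler_wpM2l// [leRHS]addrC ler_distD.
Qed.

Lemma continuous_lip_env A K : 0 <= K -> continuous (lip_env A K).
Proof.
move=> K0 x; apply/(@cvgrPdist_lt _ _ _ _ (nbhs_filter x)) => e e0.
apply/nbhs_ballP; exists (e / (K + 1)); first by rewrite /= divr_gt0// ltr_wpDl.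
move=> y; rewrite -ball_normE/= ltr_pdivlMr ?ltr_wpDl// => xy.
have := lip_env_lip A x y K0; have := lip_env_lip A y x K0.
rewrite (distrC y x) ltr_norml => h1 h2.
have := normr_ge0 (x - y) => h3.
by apply/andP; split; nra.
Qed.

Lemma le_lip_env2 A B K K' x : A `<=` B -> 0 <= K <= K' ->
  lip_env A K x <= lip_env B K' x.
Proof.
move=> AB /andP[K0 KK]; apply: le_lip_env => y.
rewrite (le_trans (lip_env_le A x y K0))// lerD ?ler_wpM2r//.
rewrite !indicE; have [/set_mem yA|//] := boolP (y \in A).
by rewrite mem_set//; exact: AB.
Qed.

(** Truncating [U] gives bounded support; as the radius and the Lipschitz constant both grow with
    [j], the sequence is nondecreasing. *)
Definition trunc_env (U : set 'rV[R]_n) (j : nat) : 'rV[R]_n -> R :=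
  lip_env (U `&` [set v | `|v| <= j%:R]) j%:R.

Lemma cvg_trunc_env (U : set 'rV[R]_n) x : open U ->
  trunc_env U j x @[j --> \oo] --> (\1_U x : R).
Proof.
move=> oU; have [/set_mem Ux|nUx] := boolP (x \in U); last first.
  rewrite indicE (negbTE nUx); apply: cvg_near_cst; apply: nearW => j.
  apply/eqP; rewrite eq_le lip_env_ge0// andbT.
  rewrite (le_trans (lip_env_le_indic _ _ _))// indicE memNset//.
  by move=> [Ux _]; move: nUx; rewrite mem_set.
have /nbhs_ballP[d /= d0 dU] : nbhs x U by exact: open_nbhs_nbhs.
rewrite indicE mem_set//; apply: cvg_near_cst; near=> j.
apply/eqP; rewrite eq_le (le_trans (lip_env_le_indic _ _ _))//=; last first.
  by rewrite indicE; case: (_ \in _).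
(* A point within distance [d] lies in [U] and, for large [j], in the truncating ball, so the
   indicator contributes [1]. For any other point the penalty is at least [d^-1 * d = 1]. *)
apply: le_lip_env => y; have [xy|xy] := ltP `|x - y| d.
  rewrite indicE mem_set ?lerDl ?mulr_ge0//; split.
    by apply: dU; rewrite -ball_normE.
  have : `|y| <= `|x| + `|x - y|.
    by rewrite (distrC x y) -[in leLHS](subrK x y) addrC ler_normD.
  move=> /le_trans; apply; apply: (@le_trans _ _ (`|x| + d)).
    by rewrite lerD2l ltW.
  by near: j; exact: nbhs_infty_ger.
have j1 : d^-1 <= j%:R by near: j; exact: nbhs_infty_ger.
have : 1 <= j%:R * `|x - y|.
  apply: (@le_trans _ _ (d^-1 * d)); first by rewrite mulVf// gt_eqF.
  by apply: ler_pM => //; rewrite ?invr_ge0 ltW.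
by move=> /le_trans; apply; rewrite lerDr.
Unshelve. all: by end_near. Qed.

End envelope.

(** * Approximate identity *)

Section mollify.
Context {R : realType} {n : nat}.
Local Notation leb := (lebesgue_rV n : {measure set 'rV[R]_n -> \bar R}).

Lemma gauss_rV_double (s : R) (v : 'rV[R]_n) : s != 0 ->
  gauss_rV s v =
  2 ^+ n * expR (- (dotp v v * 3 / (8 * s ^+ 2))) * gauss_rV (2 * s) v.
Proof.
move=> s0; rewrite /gauss_rV.
rewrite (normal_peak_double s).
rewrite exprMn mulrACA -expRD -!mulrA; congr (_ * (_ * expR _)).
by field.
Qed.

Definition mollify (s : R) (h : 'rV[R]_n -> R) (y : 'rV[R]_n) : \bar R :=
  (\int[leb]_x (h x * gauss_rV s (x - y))%:E)%E.

(** At Euclidean distance at least [d] from [y] one uses [h1 <= 1] and bounds the Gaussian by a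
    small multiple of the one of standard deviation [2 * s]. The estimate is one-sided, so that only
    nonnegative integrals occur. *)
Lemma le_mollify (s e d : R) (h1 h2 : 'rV[R]_n -> R) (y : 'rV[R]_n) :
  s != 0 -> 0 <= e ->
  measurable_fun setT h1 -> measurable_fun setT h2 ->
  (forall x, 0 <= h1 x <= 1) -> (forall x, 0 <= h2 x) ->
  (forall x, dotp (x - y) (x - y) < d ^+ 2 -> h1 x <= h2 x + e) ->
  (mollify s h1 y <= mollify s h2 y +
    (e + 2 ^+ n * expR (- (d ^+ 2 * 3 / (8 * s ^+ 2))))%:E)%E.
Proof.
move=> s0 e0 mh1 mh2 h1b h20 h12.
set c := 2 ^+ n * _.
have c0 : 0 <= c by rewrite mulr_ge0 ?expR_ge0// exprn_ge0.
have mG t : measurable_fun setT (fun x : 'rV[R]_n => gauss_rV t (x - y)).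
  by apply: measurable_gauss_rV; exact: measurable_rVB.
have G0 t (x : 'rV[R]_n) : 0 <= gauss_rV t x := gauss_rV_ge0 t x.
have mE k t : measurable_fun setT (fun x : 'rV[R]_n => (k * gauss_rV t (x - y))%:E).
  by apply/measurable_EFinP; exact: measurable_funM.
have IG k t : 0 <= k -> t != 0 ->
    (\int[leb]_x (k * gauss_rV t (x - y))%:E = k%:E)%E.
  move=> k0 t0; under eq_integral do rewrite EFinM.
  rewrite ge0_integralZl//.
  - by rewrite [X in (_ * X)%E](integral_gauss_rV y t0) mule1.
  - exact/measurable_EFinP.
  - by move=> x _; rewrite lee_fin.
have s20 : 2 * s != 0 by rewrite mulf_neq0.
have mh2G : measurable_fun setT (fun x => (h2 x * gauss_rV s (x - y))%:E).
  by apply/measurable_EFinP; exact: measurable_funM.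
have h2G x : (0 <= (h2 x * gauss_rV s (x - y))%:E)%E by rewrite lee_fin mulr_ge0.
have kG k t x : 0 <= k -> (0 <= (k * gauss_rV t (x - y))%:E)%E.
  by move=> k0; rewrite lee_fin mulr_ge0.
(* The constants [e] and [c] become integrals against the Gaussians of standard deviations [s] and
   [2 * s]; a pointwise comparison then suffices. *)
rewrite EFinD -{1}(IG e s e0 s0) -(IG c (2 * s) c0 s20).
rewrite -ge0_integralD//=; [|by move=> x _; exact: kG..].
rewrite -ge0_integralD//=; last 2 first.
- by move=> x _; rewrite adde_ge0// kG.
- by apply: emeasurable_funD; exact: mE.
apply: ge0_le_integral => //=.
- by move=> x _; rewrite lee_fin mulr_ge0//; have /andP[] := h1b x.
- by apply/measurable_EFinP; exact: measurable_funM.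
- by do 2 apply: emeasurable_funD => //; exact: mE.
- move=> x _; rewrite -!EFinD lee_fin.
  have [xd|xd] := ltP (dotp (x - y) (x - y)) (d ^+ 2).
    have := h12 x xd; have := G0 s (x - y); have := G0 (2 * s) (x - y).
    by set g := gauss_rV s _; set g2 := gauss_rV _ _; nra.
  have gc : gauss_rV s (x - y) <= c * gauss_rV (2 * s) (x - y).
    rewrite gauss_rV_double// ler_wpM2r// ler_wpM2l ?exprn_ge0//.
    have s8 : 0 <= (8 * s ^+ 2)^-1 by rewrite invr_ge0 mulr_ge0// sqr_ge0.
    by rewrite ler_expR lerN2 ler_wpM2r// ler_wpM2r.
  have /andP[? ?] := h1b x; have := h20 x; have := G0 s (x - y).
  by move: gc; set g := gauss_rV s _; set g2 := c * _; nra.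
Qed.

Lemma mollify_cst (s k : R) y : 0 <= k -> s != 0 -> mollify s (cst k) y = k%:E.
Proof.
move=> k0 s0; rewrite /mollify; under eq_integral do rewrite /= EFinM.
rewrite ge0_integralZl//.
- by rewrite [X in (_ * X)%E](integral_gauss_rV y s0) mule1.
- by apply/measurable_EFinP; apply: measurable_gauss_rV; exact: measurable_rVB.
- by move=> x _; rewrite lee_fin gauss_rV_ge0.
Qed.

Lemma mollify_ge0 s h y : (forall x, 0 <= h x) -> (0 <= mollify s h y)%E.
Proof.
by move=> h0; apply: integral_ge0 => x _; rewrite lee_fin mulr_ge0 ?gauss_rV_ge0.
Qed.

Lemma mollify_le1 s (h : 'rV[R]_n -> R) y : s != 0 -> measurable_fun setT h ->
  (forall x, 0 <= h x <= 1) -> (mollify s h y <= 1)%E.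
Proof.
move=> s0 mh hb; rewrite -(mollify_cst y ler01 s0); apply: ge0_le_integral => //=.
- by move=> x _; rewrite lee_fin mulr_ge0 ?gauss_rV_ge0//; have /andP[] := hb x.
- apply/measurable_EFinP; apply: measurable_funM => //.
  by apply: measurable_gauss_rV; exact: measurable_rVB.
- apply/measurable_EFinP; apply: measurable_funM => //.
  by apply: measurable_gauss_rV; exact: measurable_rVB.
- by move=> x _; rewrite lee_fin ler_wpM2r ?gauss_rV_ge0//; have /andP[] := hb x.
Qed.

(** Near [y] the function [h] is close to the constant [h y], which mollification fixes;
    [le_mollify] in both directions concludes. *)
Lemma cvg_mollify (h : 'rV[R]_n -> R) y : continuous h ->
  (forall x, 0 <= h x <= 1) ->
  mollify j.+1%:R^-1 h y @[j --> \oo] --> (h y)%:E.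
Proof.
move=> ch hb; have mh := continuous_measurable_rV ch.
have h0 x : 0 <= h x by have /andP[] := hb x.
have s0 j : j.+1%:R^-1 != 0 :> R by rewrite invr_eq0.
have mfin j : mollify j.+1%:R^-1 h y \is a fin_num.
  rewrite ge0_fin_numE ?mollify_ge0//.
  by rewrite (le_lt_trans (mollify_le1 _ _ _ _))// ltry.
apply/fine_cvgP; split; first exact: nearW.
apply/cvgrPdist_le => e e0.
have /(@cvgrPdist_lt _ _ _ _ (nbhs_filter y))/(_ (e / 2)) := ch y.
rewrite divr_gt0// => /(_ isT) /nbhs_ballP[d /= d0 hd].
have hd' x : dotp (x - y) (x - y) < d ^+ 2 -> `|h y - h x| < e / 2.
  move=> xd; apply: hd; rewrite -ball_normE/= distrC.
  rewrite -(ltr_pXn2r (n := 2)) ?nnegrE// ?ltW//.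
  by apply: le_lt_trans xd; exact: sqr_norm_le_dotp.
pose c j : R := 2 ^+ n * expR (- (d ^+ 2 * 3 / (8 * j.+1%:R^-1 ^+ 2))).
have c_small : \forall j \near \oo, c j < e / 2.
  (* The tail is below [e / 2] once [expR (q * j.+1%:R ^+ 2)] exceeds [K]; by [expR v >= 1 + v] it
     is enough that [j.+1%:R] is at least [K / q]. *)
  pose K : R := 2 ^+ n / (e / 2); pose q : R := d ^+ 2 * 3 / 8.
  have q0 : 0 < q by rewrite divr_gt0// mulr_gt0// exprn_gt0.
  have e20 : 0 < e / 2 by rewrite divr_gt0.
  near=> j.
  have Kj : K / q <= j.+1%:R.
    by rewrite (@le_trans _ _ j%:R) ?ler_nat//; near: j; exact: nbhs_infty_ger.
  have j1 : 1 <= j.+1%:R :> R by rewrite ler1n.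
  rewrite /c expRN -/(_ / _) ltr_pdivrMr ?expR_gt0// -ltr_pdivrMl// mulrC -/K.
  have -> : d ^+ 2 * 3 / (8 * j.+1%:R^-1 ^+ 2) = q * j.+1%:R ^+ 2.
    have : j.+1%:R != 0 :> R by [].
    by rewrite /q; set r := j.+1%:R => r0; field.
  apply: (@lt_le_trans _ _ (1 + q * j.+1%:R ^+ 2)); last exact: expR_ge1Dx.
  have : K <= q * j.+1%:R by rewrite mulrC -ler_pdivrMr.
  by have := ltW q0; nra.
near=> j => /=.
have cj : c j < e / 2 by near: j; exact: c_small.
have e20 : 0 <= e / 2 by rewrite ltW// divr_gt0.
have mc : measurable_fun setT (cst (h y) : 'rV[R]_n -> R) by exact: measurable_cst.
have le1 x : dotp (x - y) (x - y) < d ^+ 2 -> h x <= cst (h y) x + e / 2.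
  by move=> /hd'; rewrite ltr_norml => /andP[? ?] /=; lra.
have le2 x : dotp (x - y) (x - y) < d ^+ 2 -> cst (h y) x <= h x + e / 2.
  by move=> /hd'; rewrite ltr_norml => /andP[? ?] /=; lra.
have := le_mollify (s0 j) e20 mh mc hb (fun=> h0 y) le1.
have := le_mollify (s0 j) e20 mc mh (fun=> hb y) h0 le2.
rewrite !mollify_cst// -(fineK (mfin j)) -!EFinD !lee_fin -/(c j) => h1 h2.
by rewrite ler_norml; apply/andP; split; lra.
Unshelve. all: by end_near. Qed.

End mollify.

(** * Inversion and density *)

Lemma cvg_integral_nondecreasing d (T : measurableType d) {R : realType}
    (nu : {measure set T -> \bar R}) (g : nat -> T -> R) (l : T -> R) :
  (forall j, measurable_fun setT (g j)) -> (forall j x, 0 <= g j x) ->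
  (forall x, {homo g^~ x : i j / (i <= j)%N >-> i <= j}) ->
  (forall x, g j x @[j --> \oo] --> l x) ->
  (\int[nu]_x (g j x)%:E)%E @[j --> \oo] --> (\int[nu]_x (l x)%:E)%E.
Proof.
move=> mg g0 ng gl.
have mg' j : measurable_fun setT (fun x => (g j x)%:E) by exact/measurable_EFinP.
have g0' j x : setT x -> (0 <= (g j x)%:E)%E by rewrite lee_fin.
have ng' x : setT x -> {homo (fun j => (g j x)%:E) : i j / (i <= j)%N >-> (i <= j)%E}.
  by move=> _ i j ij; rewrite lee_fin ng.
have := cvg_monotone_convergence (mu := nu) measurableT mg' g0' ng'.
rewrite [X in _ --> X](_ : _ = (\int[nu]_x (l x)%:E)%E)//.
apply: eq_integral => x _; apply/cvg_lim => //.
by apply: cvg_EFin; [exact: nearW|exact: gl].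
Qed.

Section density.
Local Open Scope charge_scope.
Context {R : realType} {n : nat}.
Variable mu : {finite_measure set 'rV[R]_n -> \bar R}.
Local Notation leb := (lebesgue_rV n : {measure set 'rV[R]_n -> \bar R}).
Local Notation M := (fun xi => Normc.normc (fourier mu xi)).
Local Notation k1 := (normal_peak 1 : R).
Hypothesis finM : (\int[lebesgue_rV n]_xi (M xi)%:E < +oo)%E.

(** The inverse Fourier integral: [k1] is one over the square root of 2 pi, so the prefactor is the
    power [- n] of 2 pi. *)
Definition inv_fourier (x : 'rV[R]_n) : R :=
  k1 ^+ n ^+ 2 * \int[leb]_xi cosint mu x xi.

(** The convolution of [mu] with the normalized Gaussian of standard deviation [1 / s], an
    approximate identity as [s] grows. *)
Definition gauss_smooth (s : R) (x : 'rV[R]_n) : R :=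
  (k1 * s) ^+ n * gauss_conv mu s x.

Let mM := measurable_normc_fourier mu.
Let M0 := normc_fourier_ge0 mu.

Lemma integrable_normc_fourier : leb.-integrable setT (EFin \o M).
Proof.
apply/integrableP; split; first exact/measurable_EFinP.
by under eq_integral do rewrite /= ger0_norm//.
Qed.

Lemma integrable_mul_cosint (w : 'rV[R]_n -> R) (C : R) x :
  measurable_fun setT w -> (forall xi, `|w xi| <= C) ->
  leb.-integrable setT (EFin \o (fun xi => w xi * cosint mu x xi)).
Proof.
move=> mw wC.
have iCM : leb.-integrable setT (fun xi => (C * M xi)%:E).
  by apply: integrable_EFinZl; exact: integrable_normc_fourier.
apply: (@le_integrable _ _ _ leb _ measurableT _ (fun xi => (C * M xi)%:E)) => //.
- by apply/measurable_EFinP; apply: measurable_funM => //; exact: measurable_cosint.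
- move=> xi _; rewrite /= lee_fin normrM [leRHS]normrM (ger0_norm (M0 xi)).
  apply: ler_pM => //; last exact: cosint_le_normc.
  by rewrite (le_trans (wC xi))// ler_norm.
Qed.

Lemma integrable_cosint x : leb.-integrable setT (EFin \o (cosint mu x)).
Proof.
have := @integrable_mul_cosint (cst 1) 1 x.
rewrite (_ : (fun xi => _) = cosint mu x); last first.
  by apply/funext => xi; rewrite /= mul1r.
by apply => // xi; rewrite normr1.
Qed.

Lemma gauss_rV_ub (s : R) (v : 'rV[R]_n) : `|gauss_rV s v| <= normal_peak s ^+ n.
Proof.
rewrite ger0_norm ?gauss_rV_ge0// ler_piMr ?exprn_ge0 ?normal_peak_ge0//.
by rewrite -expR0 ler_expR oppr_le0 divr_ge0 ?dotp_ge0// mulr_ge0 ?sqr_ge0.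
Qed.

(** Integrability of the Fourier transform allows the integral to be split and the mass to be
    cancelled. *)
Lemma gauss_convE (s : R) x : s != 0 ->
  gauss_conv mu s x = \int[leb]_xi (gauss_rV s xi * cosint mu x xi).
Proof.
move=> s0; have := integral_gauss_cosint mu x s0.
have mg : measurable_fun setT (fun xi : 'rV[R]_n => gauss_rV s xi).
  exact: measurable_gauss_rV.
have ic := @integrable_mul_cosint _ _ x mg (gauss_rV_ub s).
have ig : leb.-integrable setT (fun xi => (fine (mu setT) * gauss_rV s xi)%:E).
  apply: integrable_EFinZl; apply/integrableP; split; first exact/measurable_EFinP.
  under eq_integral do rewrite /= ger0_norm ?gauss_rV_ge0//.
  by rewrite [ltLHS](integral_gauss_rV0 s0) ltry.
under eq_integral do rewrite mulrDr (mulrC _ (fine _)) EFinD.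
rewrite (integralD measurableT ig ic).
under eq_integral do rewrite EFinM.
rewrite ge0_integralZl//; last 3 first.
- exact/measurable_EFinP.
- by move=> xi _; rewrite lee_fin gauss_rV_ge0.
- by rewrite lee_fin fine_ge0.
rewrite [X in (_ * X)%E](integral_gauss_rV0 s0) mule1 EFinD.
move=> /(congr1 (fun z => (- (fine (mu setT))%:E + z)%E)).
rewrite !addeA -EFinN -EFinD addNr !add0e => E.
by rewrite /Rintegral [X in fine X]E.
Qed.

Lemma measurable_damping (s : R) : measurable_fun setT
  (fun xi : 'rV[R]_n => expR (- (dotp xi xi / (s ^+ 2 * 2)))).
Proof.
apply: measurableT_comp => //; apply: measurableT_comp => //.
by apply: measurable_funM => //; exact: measurable_dotp.
Qed.

Lemma damping_le1 (s : R) (xi : 'rV[R]_n) :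
  `|expR (- (dotp xi xi / (s ^+ 2 * 2)))| <= 1.
Proof.
rewrite ger0_norm ?expR_ge0// -expR0 ler_expR oppr_le0.
by rewrite divr_ge0 ?dotp_ge0// mulr_ge0 ?sqr_ge0.
Qed.

(** The factor [s ^+ n] cancels the [s] in the normalization of the frequency density. What is left
    is the inversion integral with a damping factor that tends to [1]. *)
Lemma gauss_smoothE (s : R) x : 0 < s -> gauss_smooth s x =
  k1 ^+ n ^+ 2 * \int[leb]_xi (expR (- (dotp xi xi / (s ^+ 2 * 2))) * cosint mu x xi).
Proof.
move=> s0; rewrite /gauss_smooth gauss_convE ?gt_eqF//.
have ie := @integrable_mul_cosint _ _ x (measurable_damping s) (damping_le1 s).
rewrite /gauss_rV; under eq_Rintegral do rewrite -mulrA.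
rewrite RintegralZl// mulrA; congr (_ * _).
by rewrite -exprMn (normal_peakE s) gtr0_norm// mulrA mulfK ?gt_eqF// -expr2 exprAC.
Qed.

Lemma gauss_smooth_integral (s : R) x : 0 < s ->
  (gauss_smooth s x)%:E = (\int[mu]_y (gauss_rV s^-1 (x - y))%:E)%E.
Proof.
move=> s0; have k0 : 0 <= k1 * s by rewrite mulr_ge0 ?normal_peak_ge0// ltW.
have mk := measurable_gauss_kernel s x.
have ig : mu.-integrable setT
    (fun y => (expR (- (s ^+ 2 * dotp (x - y) (x - y) / 2)))%:E).
  by apply: (@integrable_bounded _ _ _ _ 1) => // y; exact: gauss_kernel_le1.
rewrite /gauss_smooth EFinM /gauss_conv /Rintegral fineK; last first.
  exact: integrable_fin_num.
rewrite -ge0_integralZl//.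
- apply: eq_integral => y _; rewrite -EFinM /gauss_rV.
  rewrite (normal_peakE s^-1) gtr0_norm ?invr_gt0// invrK (mulrC s); congr (_ * expR _)%:E.
  by field; rewrite gt_eqF.
- exact/measurable_EFinP.
- by rewrite lee_fin exprn_ge0.
Qed.

Lemma cvg_damping (xi : 'rV[R]_n) :
  expR (- (dotp xi xi / (j.+1%:R ^+ 2 * 2))) @[j --> \oo] --> (1 : R).
Proof.
rewrite -[X in _ --> X]expR0; apply: continuous_cvg; first exact: continuous_expR.
rewrite (_ : (fun j => _) = fun j => - (dotp xi xi / 2) * (harmonic j * harmonic j)).
  rewrite -(mulr0 (- (dotp xi xi / 2))); apply: cvgM; first exact: cvg_cst.
  by rewrite -(mulr0 0); apply: cvgM; exact: cvg_harmonic.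
apply/funext => j; rewrite /harmonic/=.
have : j.+1%:R != 0 :> R by [].
by set r := j.+1%:R => r0; field.
Qed.

(** The difference is at most a multiple of the integral of [(1 - w j xi) * M xi], free of [x],
    which tends to zero by dominated convergence. *)
Lemma inv_fourier_approx (e : R) : 0 < e -> \forall j \near \oo,
  forall x, `|inv_fourier x - gauss_smooth j.+1%:R x| <= e.
Proof.
move=> e0; pose w j (xi : 'rV[R]_n) : R := expR (- (dotp xi xi / (j.+1%:R ^+ 2 * 2))).
have mw j : measurable_fun setT (w j) := measurable_damping j.+1%:R.
have w1 j xi : `|w j xi| <= 1 := damping_le1 j.+1%:R xi.
have w0 j xi : 0 <= w j xi := expR_ge0 _.
have iM := integrable_normc_fourier.
have dM j xi : `|(1 - w j xi) * M xi| <= M xi.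
  rewrite normrM (ger0_norm (M0 xi)) ler_piMl//.
  by have := w1 j xi; have := w0 j xi; rewrite !ler_norml; lra.
have mdM j : measurable_fun setT (fun xi => (1 - w j xi) * M xi).
  by apply: measurable_funM => //; exact: measurable_funB.
have idM j : leb.-integrable setT (EFin \o (fun xi => (1 - w j xi) * M xi)).
  apply: (le_integrable measurableT _ _ iM); first exact/measurable_EFinP.
  by move=> xi _; rewrite /= lee_fin (ger0_norm (M0 xi)).
have c0 : (\int[leb]_xi ((1 - w j xi) * M xi)%:E)%E @[j --> \oo] --> 0%E.
  rewrite -(integral0 leb setT).
  apply: (@dominated_cvg _ _ _ leb _ measurableT
    (fun j xi => ((1 - w j xi) * M xi)%:E) (cst 0%E) (EFin \o M)) => //.
  - by move=> j; exact/measurable_EFinP.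
  - move=> xi _; apply: cvg_EFin; first exact: nearW.
    rewrite -(mul0r (M xi)) -(subrr 1); apply: cvgM; last exact: cvg_cst.
    by apply: cvgB; [exact: cvg_cst|exact: cvg_damping].
  - by move=> j xi _; rewrite lee_fin; exact: dM.
have k0 : 0 <= k1 ^+ n ^+ 2 by exact: sqr_ge0.
have kd : k1 ^+ n ^+ 2 * \int[leb]_xi ((1 - w j xi) * M xi) @[j --> \oo] --> 0.
  rewrite -[X in _ --> X](mulr0 (k1 ^+ n ^+ 2)).
  apply: cvgM; first exact: cvg_cst.
  exact: (fine_cvg c0).
have /cvgrPdist_le/(_ _ e0) := kd; apply: filterS => j dj x.
rewrite sub0r normrN in dj.
apply: le_trans (le_trans (ler_norm _) dj).
have ic := integrable_cosint x.
have iwc := @integrable_mul_cosint _ _ x (mw j) (w1 j).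
have iB : leb.-integrable setT
    (EFin \o (fun xi => cosint mu x xi - w j xi * cosint mu x xi)).
  by rewrite /comp; under eq_fun do rewrite EFinB; exact: integrableB.
rewrite gauss_smoothE// /inv_fourier -mulrBr normrM (ger0_norm k0) ler_wpM2l//.
rewrite -RintegralB//.
rewrite (le_trans (le_normr_Rintegral _ iB))//.
apply: le_Rintegral => //.
- exact: (integrable_abse iB).
- move=> xi _; rewrite -{1}(mul1r (cosint _ _ _)) -mulrBl normrM.
  apply: ler_pM => //; last exact: cosint_le_normc.
  by have := w1 j xi; have := w0 j xi; rewrite !ler_norml; lra.
Qed.

Lemma C_infty_inv_fourier : C_infty inv_fourier.
Proof.
apply: C_infty_unif_lim => e /inv_fourier_approx[N _ /(_ N (leqnn _)) eN].
exists (gauss_smooth N.+1%:R) => //.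
by apply: C_infty_scale; exact: C_infty_gauss_conv.
Qed.

Lemma cvg_gauss_smooth x : gauss_smooth j.+1%:R x @[j --> \oo] --> inv_fourier x.
Proof.
apply/cvgrPdist_le => e /inv_fourier_approx.
by apply: filterS => j; exact.
Qed.

Lemma inv_fourier_ge0 x : 0 <= inv_fourier x.
Proof.
have := @cvg_gauss_smooth x => cx; rewrite -(cvg_lim _ cx)//.
apply: limr_ge; first by apply/cvg_ex; exists (inv_fourier x).
apply: nearW => j; apply: mulr_ge0.
  by rewrite exprn_ge0// mulr_ge0// normal_peak_ge0.
by apply: Rintegral_ge0 => y _; exact: expR_ge0.
Qed.

Lemma gauss_smooth_ub s x : 0 < s ->
  `|gauss_smooth s x| <= k1 ^+ n ^+ 2 * \int[leb]_xi M xi.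
Proof.
move=> s0; have k0 : 0 <= k1 ^+ n ^+ 2 by exact: sqr_ge0.
have iwc := @integrable_mul_cosint _ _ x (measurable_damping s) (damping_le1 s).
rewrite gauss_smoothE// normrM (ger0_norm k0) ler_wpM2l//.
rewrite (le_trans (le_normr_Rintegral _ _))//.
apply: le_Rintegral => //.
- exact: (integrable_abse iwc).
- exact: integrable_normc_fourier.
- move=> xi _; rewrite normrM -[leRHS]mul1r.
  by apply: ler_pM => //; [exact: damping_le1|exact: cosint_le_normc].
Qed.

Let continuous_inv_fourier : continuous inv_fourier.
Proof. by have [] := C_infty_inv_fourier. Qed.

Let measurable_inv_fourier : measurable_fun setT inv_fourier.
Proof. exact: continuous_measurable_rV. Qed.

(** Domination by the indicator of a box, whose measure is a finite product. *)
Lemma integrable_bounded_support (f : 'rV[R]_n -> R) (N : R) :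
  0 <= N -> measurable_fun setT f -> (forall x, 0 <= f x <= 1) ->
  (forall x, N < `|x| -> f x = 0) -> leb.-integrable setT (EFin \o f).
Proof.
move=> N0 mf fb fN; pose A := [set v : 'rV[R]_n | forall i, v ord0 i \in `[-N, N]].
have mA : measurable A.
  rewrite (_ : A = \bigcap_(i in [set: 'I_n])
      (fun v : 'rV[R]_n => v ord0 i) @^-1` `[-N, N]%classic).
    apply: fin_bigcap_measurable => // i _; rewrite -[X in measurable X]setTI.
    exact: measurable_coord.
  by apply/seteqP; split=> v /= Av i; [move=> _|]; exact: Av.
have Afin : (lebesgue_rV n A < +oo)%E.
  rewrite (lebesgue_rV_box (A := fun=> `[-N, N]%classic))//.
  under eq_bigr do rewrite lebesgue_measure_itv/=.
  rewrite (eq_bigr (fun=> (if (- N < N)%R then N - - N else 0)%:E)).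
    by rewrite prodEFin ltry.
  by move=> i _; rewrite lte_fin; case: ifP.
apply/integrableP; split; first exact/measurable_EFinP.
apply: le_lt_trans Afin.
rewrite -(setIT A) -integral_indic//.
apply: ge0_le_integral => //.
- exact/measurable_EFinP/measurableT_comp.
- exact/measurable_EFinP.
- move=> x _ /=; have /andP[f0 f1] := fb x; rewrite lee_fin ger0_norm//.
  rewrite indicE; have [xA|/negP xA] := boolP (x \in A); first by [].
  rewrite fN//; rewrite ltNge; apply/negP => xN; apply: xA; rewrite inE => i.
  rewrite in_itv/= -ler_norml; exact: le_trans (coord_le_norm x i) xN.
Qed.

(** Tonelli's theorem moves the smoothing from [mu] to [f]. Both sides then converge by dominated
    convergence: one under a multiple of [f], integrable by its bounded support, the other under the
    constant [1], as [mu] is finite. *)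
Lemma integral_inv_fourier_cont (f : 'rV[R]_n -> R) (N : R) :
  0 <= N -> continuous f -> (forall x, 0 <= f x <= 1) ->
  (forall x, N < `|x| -> f x = 0) ->
  (\int[mu]_y (f y)%:E = \int[leb]_x (f x * inv_fourier x)%:E)%E.
Proof.
move=> N0 cf fb fN; have mf := continuous_measurable_rV cf.
have f0 x : 0 <= f x by have /andP[] := fb x.
have sp j : 0 < j.+1%:R :> R by rewrite ltr0n.
have mg s : measurable_fun setT (fun p : 'rV[R]_n * 'rV[R]_n =>
    (f p.1 * gauss_rV s (p.1 - p.2))%:E).
  apply/measurable_EFinP; apply: measurable_funM; first exact: measurableT_comp mf _.
  by apply: measurable_gauss_rV; exact: measurable_rVB.
have fg0 s p : (0 <= (f p.1 * gauss_rV s (p.1 - p.2))%:E)%E.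
  by rewrite lee_fin mulr_ge0 ?gauss_rV_ge0.
have E j : (\int[leb]_x (f x * gauss_smooth j.+1%:R x)%:E =
    \int[mu]_y mollify j.+1%:R^-1 f y)%E.
  rewrite /mollify -(@fubini_tonelli _ _ _ _ _ (lebesgue_rV n) mu _ (mg _) (fg0 _)).
  apply: eq_integral => x _; rewrite EFinM gauss_smooth_integral//.
  rewrite -ge0_integralZl//.
  - apply/measurable_EFinP; apply: measurable_gauss_rV; exact: measurable_rVB.
  - by move=> y _; rewrite lee_fin gauss_rV_ge0.
  - by rewrite lee_fin.
have cl : (\int[leb]_x (f x * gauss_smooth j.+1%:R x)%:E)%E @[j --> \oo] -->
    (\int[leb]_x (f x * inv_fourier x)%:E)%E.
  pose B := k1 ^+ n ^+ 2 * \int[leb]_xi M xi.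
  have mV j : measurable_fun setT (gauss_smooth j.+1%:R).
    apply: continuous_measurable_rV.
    have [] // : C_infty (gauss_smooth j.+1%:R).
    by apply: C_infty_scale; exact: C_infty_gauss_conv.
  apply: (@dominated_cvg _ _ _ leb _ measurableT
    (fun j x => (f x * gauss_smooth j.+1%:R x)%:E) _ (fun x => (B * f x)%:E)) => //.
  - by move=> j; apply/measurable_EFinP; exact: measurable_funM.
  - move=> x _; apply: cvg_EFin; first exact: nearW.
    by apply: cvgM; [exact: cvg_cst|exact: cvg_gauss_smooth].
  - by apply: integrable_EFinZl; exact: integrable_bounded_support fN.
  - move=> j x _; rewrite lee_fin normrM (ger0_norm (f0 x)) mulrC ler_wpM2r//.
    exact: gauss_smooth_ub.
have cr : (\int[mu]_y mollify j.+1%:R^-1 f y)%E @[j --> \oo] -->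
    (\int[mu]_y (f y)%:E)%E.
  apply: (@dominated_cvg _ _ _ mu _ measurableT
    (fun j y => mollify j.+1%:R^-1 f y) _ (cst 1%E)) => //.
  - move=> j; exact: (@measurable_fun_fubini_tonelli_G _ _ _ _ _ leb _ (mg _) (fg0 _)).
  - by move=> y _; exact: cvg_mollify.
  - by apply: (@integrable_bounded _ _ _ (cst 1) 1) => // y; rewrite normr1.
  - move=> j y _; rewrite gee0_abs ?mollify_ge0// mollify_le1//.
by move: cl; rewrite (funext E) => cl; exact: (cvg_unique _ cr cl).
Qed.

(** Monotone convergence along [trunc_env U], on the right thanks to the nonnegativity of
    [inv_fourier]. *)
Lemma integral_inv_fourier_open (U : set 'rV[R]_n) : open U ->
  mu U = (\int[leb]_(x in U) (inv_fourier x)%:E)%E.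
Proof.
move=> oU; have mU := open_measurable_rV oU.
have ct j : continuous (trunc_env U j) by exact: continuous_lip_env.
have mt j : measurable_fun setT (trunc_env U j) by exact: continuous_measurable_rV.
have t0 j x : 0 <= trunc_env U j x by exact: lip_env_ge0.
have tb j x : 0 <= trunc_env U j x <= 1.
  by rewrite t0/= (le_trans (lip_env_le_indic _ _ _))// indicE.
have ts j x : j%:R < `|x| -> trunc_env U j x = 0.
  move=> jx; apply/eqP; rewrite eq_le t0 andbT.
  rewrite (le_trans (lip_env_le_indic _ _ _))// indicE memNset//=.
  by move=> [_]; rewrite /= leNgt jx.
have nt x : {homo (fun j => trunc_env U j x) : i j / (i <= j)%N >-> i <= j}.
  move=> i j ij; apply: le_lip_env2; last by rewrite ler0n ler_nat.
  by move=> v [Uv iv]; split => //=; rewrite (le_trans iv)// ler_nat.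
have E j := integral_inv_fourier_cont (ler0n _ j) (ct j) (tb j) (ts j).
have cl : (\int[mu]_y (trunc_env U j y)%:E)%E @[j --> \oo] -->
    (\int[mu]_y (\1_U y)%:E)%E.
  by apply: cvg_integral_nondecreasing => // x; exact: cvg_trunc_env.
have cr : (\int[leb]_x (trunc_env U j x * inv_fourier x)%:E)%E @[j --> \oo] -->
    (\int[leb]_x (\1_U x * inv_fourier x)%:E)%E.
  apply: cvg_integral_nondecreasing.
  - by move=> j; exact: measurable_funM.
  - by move=> j x; rewrite mulr_ge0// inv_fourier_ge0.
  - by move=> x i j ij; rewrite ler_wpM2r ?inv_fourier_ge0// nt.
  - by move=> x; apply: cvgM; [exact: cvg_trunc_env|exact: cvg_cst].
transitivity (\int[mu]_y (\1_U y)%:E)%E.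
  by rewrite integral_indic// setIT.
transitivity (\int[leb]_x (\1_U x * inv_fourier x)%:E)%E; last first.
  rewrite [RHS]integral_mkcond; apply: eq_integral => x _.
  by rewrite patchE indicE; case: ifPn; rewrite ?mul1r ?mul0r.
by move: cl; rewrite (funext E) => cl; exact: (cvg_unique _ cl cr).
Qed.

(** * From open sets to Borel sets, and the Radon-Nikodym derivative *)

Let nu (A : set 'rV[R]_n) := (\int[leb]_(x in A) (inv_fourier x)%:E)%E.

Let nu0 : nu set0 = 0%E. Proof. by rewrite /nu integral_set0. Qed.

Let nu_ge0 A : (0 <= nu A)%E.
Proof. by apply: integral_ge0 => x _; rewrite lee_fin inv_fourier_ge0. Qed.

Let nu_sigma_additive : semi_sigma_additive nu.
Proof.
apply: semi_sigma_additive_nng_induced; first exact/measurable_EFinP.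
by move=> x; rewrite lee_fin inv_fourier_ge0.
Qed.

HB.instance Definition _ := isMeasure.Build _ _ _ nu nu0 nu_ge0 nu_sigma_additive.

(** The open sets are stable under intersection and generate the Borel sets, and [mu] is finite, so
    agreement on open sets determines the measure. *)
Lemma integral_inv_fourier (A : set 'rV[R]_n) : measurable A ->
  mu A = (\int[leb]_(x in A) (inv_fourier x)%:E)%E.
Proof.
apply: (measure_unique (@open 'rV[R]_n) (fun=> setT) rV_measurableE _ _ _ mu nu).
- exact: openI.
- by move=> i; exact: openT.
- by rewrite bigcup_const//; exists 0%N.
- by move=> U; exact: integral_inv_fourier_open.
- by move=> i; rewrite -ge0_fin_numE// fin_num_measure.
Qed.

Lemma dominates_inv_fourier : mu `<< lebesgue_rV n.
Proof.
apply/null_content_dominatesP => A mA A0.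
rewrite integral_inv_fourier//; apply: null_set_integral => //.
exact/measurable_EFinP/measurable_funTS.
Qed.

(** Two functions with the same integral over every measurable set, one of them integrable, agree
    almost everywhere. *)
Lemma Radon_Nikodym_inv_fourier :
  ae_eq (lebesgue_rV n) setT
    ('d (charge_of_finite_measure mu) '/d (lebesgue_rV n))
    (EFin \o inv_fourier).
Proof.
have dom : charge_of_finite_measure mu `<< lebesgue_rV n.
  exact: dominates_inv_fourier.
apply: integral_ae_eq => //.
- exact: Radon_Nikodym_integrable.
- exact/measurable_EFinP.
- move=> E _ mE; rewrite -Radon_Nikodym_integral//.
  exact: integral_inv_fourier.
Qed.

End density.

Theorem corollary5p3 (R : realType) (k n : nat) (hk : (1 <= k)%N)
    (hn : (1 <= n)%N) (X : 'rV[R]_k -> 'rV[R]_n)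
    (mX : measurable_fun (unit_cube k) X) :
  (forall alpha : R, 0 < alpha < n%:R ->
     (\int[lebesgue_rV n]_xi
        ((Normc.normc (fourier (occupation mX) xi))%:E
         * epowR (enorm xi) (- alpha)) < +oo)%E ->
     exists2 U : 'rV[R]_n -> R, C_infty U &
       riesz_potential alpha (occupation mX) = EFin \o U) /\
  ((\int[lebesgue_rV n]_xi
      (Normc.normc (fourier (occupation mX) xi))%:E < +oo)%E ->
   exists2 L : 'rV[R]_n -> R, C_infty L & is_local_time mX L).

Proof.
split=> [alpha alphan fin|fin]; first exact: C_infty_riesz_potential.
exists (inv_fourier (occupation mX)); first exact: C_infty_inv_fourier.
split; first exact: dominates_inv_fourier.
exact: Radon_Nikodym_inv_fourier.
Qed.
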